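(* There exist $n\in\mathbb{N}$, entire functions $a_0,\dots,a_{n-1}$ of completely regular growth, and a transcendental entire function $f$ of finite order which is not of completely regular growth, such that $$f^{(n)}+a_{n-1}f^{(n-1)}+\dots+a_1f'+a_0f=0.$$
   Context: The order of an entire function $f$ is $\limsup_{r\to\infty}\frac{\log\log M(r,f)}{\log r}$, where $M(r,f)=\max_{|z|=r}|f(z)|$. An entire function $F$ of (finite) order $\rho$ is said to be of completely regular growth (in the sense of Levin and Pfluger) if there exists a $2\pi$-periodic function $h\colon\mathbb{R}\to\mathbb{R}$ which does not vanish identically such that $$\log|F(re^{i\theta})|=h(\theta)r^\rho+o(r^\rho)$$ as $r\to\infty$ (uniformly in $\theta$), for $re^{i\theta}$ outside a union of disks $\{z:|z-c_j|<r_j\}$ (a countable family) satisfying $\sum_{|c_j|\le r}r_j=o(r)$ as $r\to\infty$. *)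

(* Defs.v *)
From mathcomp Require Import all_boot all_order all_algebra.
From mathcomp Require Export complex.
From mathcomp Require Import all_classical all_reals all_analysis.
Import Order.TTheory GRing.Theory Num.Theory.
Import numFieldNormedType.Exports.

Set Implicit Arguments.
Unset Strict Implicit.
Unset Printing Implicit Defensive.

Local Open Scope complex_scope.
Local Open Scope ring_scope.
Local Open Scope classical_set_scope.

(* R[i] packaged as a numFieldType: the generic instances for numFieldType
   then provide its topology and its structure of normed module over itself,
   so that [derivable _ _ 1] and [derive1n] are complex derivatives. *)
Definition Cplx (R : realType) : numFieldType := R[i].

(* The norm `|z| of Cplx R takes its values in Cplx R; this one is R-valued. *)
Definition modulus (R : realType) (z : Cplx R) : R := Normc.normc z.

Definition polar (R : realType) (r t : R) : Cplx R :=
  (r * cos t) +i* (r * sin t).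

Definition entire (R : realType) (f : Cplx R -> Cplx R) : Prop :=
  forall z, derivable f z 1.

Definition transcendental_entire (R : realType) (f : Cplx R -> Cplx R) : Prop :=
  entire f /\ ~ exists p : {poly Cplx R}, forall z, f z = p.[z].

(* For continuous f and 0 <= r the supremum is attained, since the circle is
   compact and nonempty. *)
Definition max_modulus (R : realType) (f : Cplx R -> Cplx R) (r : R) : R :=
  sup [set modulus (f z) | z in [set z | modulus z = r]].

(* Since ln x = 0 for x <= 0, constant functions get order 0, as usual. *)
Definition growth_order (R : realType) (f : Cplx R -> Cplx R) : \bar R :=
  limf_esup (fun r : R => (ln (ln (max_modulus f r)) / ln r)%:E)
            (pinfty_nbhs R).

(* The sum ranges over the possibly infinitely many j with |c_j| <= r, hence
   is extended-real-valued. A radius may be 0, which makes the disk empty: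
   finite families of disks are thereby included. *)
Definition exceptional_disks (R : realType) (c : nat -> Cplx R) (rad : nat -> R)
    : Prop :=
  (forall j, 0 <= rad j) /\
  (forall eps : R, 0 < eps -> \forall r \near +oo,
     (\esum_(j in [set j | (modulus (c j) <= r)%R]) (rad j)%:E
        <= (eps * r)%:E)%E).

(* Outside the disks F is required not to vanish: at a zero of F, log |F| is
   -oo, whereas ln 0 = 0. *)
Definition completely_regular_growth (R : realType) (F : Cplx R -> Cplx R)
    : Prop :=
  exists (rho : R) (h : R -> R) (c : nat -> Cplx R) (rad : nat -> R),
    [/\ growth_order F = rho%:E,
        (forall t, h (t + 2 * pi) = h t),
        (exists t, h t <> 0),
        exceptional_disks c rad
      & forall eps : R, 0 < eps -> \forall r \near +oo, forall t : R,
          (forall j, ~ modulus (polar r t - c j) < rad j) ->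
          F (polar r t) <> 0 /\
          `| ln (modulus (F (polar r t))) - h t * r `^ rho | <= eps * r `^ rho].

(* Main.v *)
Require Import Defs.
From mathcomp Require Import all_boot all_order all_algebra.
From mathcomp Require Import all_classical all_reals all_analysis.
From mathcomp Require Import ring lra.
Import Order.TTheory GRing.Theory Num.Theory.
Import numFieldNormedType.Exports.

(** Let f(z) = prod_(k >= 0) (1 + q^k z) with q = 1/16, so f(z) = (1 + z) f(qz).
    Its growth log M(r, f) is of the exact order (log r)^2: it has order 0 and
    log |f| is unbounded, hence it is not of completely regular growth.

    There are power series P and N, with coefficients of the size of those of f,
    such that N f - z P f' is invariant under z -> qz, hence a constant c, and
    c > 0. For every entire g this makes f a solution of f'' + a_1 f' + a_0 f = 0
    with a_1 = g f + z P f'' / c and a_0 = - g f' - N f'' / c.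

    Take g = z^4 f (e^z + 1). Outside small disks around the zeros of f and of
    e^z + 1 one has |f| >= 1 and |f'/f| >= 1/|z|, while f''/f and P/f are bounded
    by a power of log |z|. Hence z^4 f^2 (e^z + 1) dominates a_1, and a_0 is
    controlled through a_0 f = - f'' - a_1 f'; both coefficients have order 1 and
    indicator max(cos t, 0). *)

Local Open Scope complex_scope.
Local Open Scope ring_scope.
Local Open Scope classical_set_scope.

Set Implicit Arguments.
Unset Strict Implicit.
Unset Printing Implicit Defensive.

(** * Modulus and complex derivatives *)

Section Modulus.
Variable R : realType.
Implicit Types (z w : Cplx R) (x y : R).

(** If f solves f'' + a_1 f' + a_0 f = 0, then a_1 = - f''/f' at every simple zero of f. At such a
    zero N f - z P f' = c reads z P / c = - 1/f', so z P f''/c takes the required values, and g f is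
    the freedom that remains. Comparing coefficients in the functional equations of P and N gives
    recursions x_i = q^i (b_i - x_(i+1)). Solved forward they multiply errors by q^-i and explode
    for all but one initial value; the bounded solution is computed from infinity, and its
    boundedness is what keeps P and N comparable with f. The delicate coefficient is a_0: its lower
    bound goes through the equation and needs z f'/f to stay away from 0. For |z| near 16^m the
    factors with k < m contribute nearly 1 each to z f'/f, about m in all, while the two factors
    that can be small may contribute 4/d, where d is their relative distance from 0. Hence d of size
    1/m is allowed, provided the constant is large enough: d = 7/(m+2) works because 4/7 + 1/15 < 1.
    Disks of relative radius of order 1/k around -16^k still have total radius o(r). *)

Definition rc x : Cplx R := x%:C.

Lemma rcD x y : rc (x + y) = rc x + rc y. Proof. exact: rmorphD. Qed.
Lemma rcM x y : rc (x * y) = rc x * rc y. Proof. exact: rmorphM. Qed.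
Lemma rcX x n : rc (x ^+ n) = rc x ^+ n. Proof. exact: rmorphXn. Qed.
Lemma rc0 : rc 0 = 0. Proof. by []. Qed.
Lemma rc1 : rc 1 = 1. Proof. by []. Qed.

Lemma normE z : `|z| = rc (modulus z). Proof. by []. Qed.

Lemma exprn_mono x y n : 0 <= x -> x <= y -> x ^+ n <= y ^+ n.
Proof. by move=> x0 xy; rewrite lerXn2r ?nnegrE// (le_trans x0). Qed.

Lemma ltr_rc x y : (rc x < rc y) = (x < y). Proof. exact: ltcR. Qed.

Lemma modulus_ge0 z : 0 <= modulus z.
Proof. by rewrite /modulus; case: z => a b /=; rewrite sqrtr_ge0. Qed.

Lemma modulusM z w : modulus (z * w) = modulus z * modulus w.
Proof. exact: Normc.normcM. Qed.

Lemma modulusD z w : modulus (z + w) <= modulus z + modulus w.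
Proof. exact: le_normcD. Qed.

Lemma modulusN z : modulus (- z) = modulus z.
Proof. exact: normcN. Qed.

Lemma modulus0 : modulus (0 : Cplx R) = 0. Proof. exact: Normc.normc0. Qed.
Lemma modulus1 : modulus (1 : Cplx R) = 1. Proof. exact: Normc.normc1. Qed.

Lemma modulusV z : modulus z^-1 = (modulus z)^-1.
Proof. exact: Normc.normcV. Qed.

Lemma modulusX z n : modulus (z ^+ n) = modulus z ^+ n.
Proof.
elim: n => [|n IH]; first by rewrite !expr0 modulus1.
by rewrite !exprS modulusM IH.
Qed.

Lemma modulus_rc x : modulus (rc x) = `|x|.
Proof. by rewrite /modulus /= expr0n addr0 sqrtr_sqr. Qed.

Lemma modulus_eq0 z : (modulus z == 0) = (z == 0).
Proof.
by apply/eqP/eqP => [/Normc.eq0_normc //|->]; rewrite modulus0.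
Qed.

Lemma modulus_gt0 z : (0 < modulus z) = (z != 0).
Proof. by rewrite lt_neqAle modulus_ge0 andbT eq_sym modulus_eq0. Qed.

Lemma modulusB_sym z w : modulus (z - w) = modulus (w - z).
Proof. by rewrite -modulusN opprB. Qed.

Lemma modulusB z w : modulus (z - w) <= modulus z + modulus w.
Proof. by rewrite -(modulusN w) modulusD. Qed.

Lemma modulus_add4 z1 z2 z3 z4 : modulus (z1 + z2 - z3 - z4) <=
  modulus z1 + modulus z2 + modulus z3 + modulus z4.
Proof.
apply: le_trans (modulusB _ _) _; rewrite lerD2r.
by apply: le_trans (modulusB _ _) _; rewrite lerD2r modulusD.
Qed.

Lemma modulusD_ge z w : modulus z - modulus w <= modulus (z + w).
Proof.
have := modulusB (z + w) w; rewrite addrK; lra.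
Qed.

Lemma modulusB_ge z w : modulus z - modulus w <= modulus (z - w).
Proof. by rewrite -(modulusN w) modulusD_ge. Qed.

Lemma modulus_sum n (F : 'I_n -> Cplx R) :
  modulus (\sum_(i < n) F i) <= \sum_(i < n) modulus (F i).
Proof.
elim: n F => [|n IH] F; first by rewrite !big_ord0 modulus0.
by rewrite !big_ord_recr /= (le_trans (modulusD _ _))// lerD2r IH.
Qed.

Lemma ReD z w : complex.Re (z + w) = complex.Re z + complex.Re w.
Proof. by case: z => a b; case: w. Qed.
Lemma ImD z w : complex.Im (z + w) = complex.Im z + complex.Im w.
Proof. by case: z => a b; case: w. Qed.
Lemma ReN z : complex.Re (- z) = - complex.Re z. Proof. by case: z. Qed.
Lemma ImN z : complex.Im (- z) = - complex.Im z. Proof. by case: z. Qed.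
Lemma Re_rcM x z : complex.Re (rc x * z) = x * complex.Re z.
Proof. by case: z => a b; rewrite /= mul0r subr0. Qed.
Lemma Im_rcM x z : complex.Im (rc x * z) = x * complex.Im z.
Proof. by case: z => a b; rewrite /= mul0r addr0. Qed.

Lemma Re_sum n (F : 'I_n -> Cplx R) :
  complex.Re (\sum_(i < n) F i) = \sum_(i < n) complex.Re (F i).
Proof. by elim: n F => [|n IH] F; rewrite ?big_ord0// !big_ord_recr ReD IH. Qed.
Lemma Im_sum n (F : 'I_n -> Cplx R) :
  complex.Im (\sum_(i < n) F i) = \sum_(i < n) complex.Im (F i).
Proof. by elim: n F => [|n IH] F; rewrite ?big_ord0// !big_ord_recr ImD IH. Qed.

Lemma ler_Re_modulus z : `|complex.Re z| <= modulus z.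
Proof.
case: z => a b; rewrite /modulus /= -sqrtr_sqr ler_sqrt ?addr_ge0 ?sqr_ge0//.
by rewrite lerDl sqr_ge0.
Qed.

Lemma ler_Im_modulus z : `|complex.Im z| <= modulus z.
Proof.
case: z => a b; rewrite /modulus /= -sqrtr_sqr ler_sqrt ?addr_ge0 ?sqr_ge0//.
by rewrite lerDr sqr_ge0.
Qed.

Lemma modulus_le_ReIm z : modulus z <= `|complex.Re z| + `|complex.Im z|.
Proof.
have -> : z = rc (complex.Re z) + (0 +i* 1) * rc (complex.Im z).
  by case: z => a b; apply/eqP; rewrite eq_complex /=; apply/andP; split; apply/eqP; ring.
apply: le_trans (modulusD _ _) _; rewrite modulusM !modulus_rc.
have -> : modulus ((0 +i* 1) : Cplx R) = 1.
  by rewrite /modulus /= expr0n /= add0r expr1n sqrtr1.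
rewrite mul1r ReD ImD.
by case: z => a b /=; rewrite !(mul0r,mulr0,mul1r,mulr1,subr0,addr0,add0r).
Qed.

Lemma modulus_polar x y : 0 <= x -> modulus (polar x y) = x.
Proof.
move=> x0; rewrite /modulus /= !exprMn -mulrDr cos2Dsin2 mulr1.
by rewrite sqrtr_sqr ger0_norm.
Qed.

(** A remainder quadratic in [h] leaves the difference quotient within a multiple of [modulus h] of
    [l]. Power series and the exponential both come with such a remainder, so this is the only place
    where a complex derivative is taken from its definition as a limit. *)
Lemma is_derive_quadratic (F : Cplx R -> Cplx R) z l (B : R) :
  (forall h, modulus h <= 2^-1 ->
     modulus (F (z + h) - F z - h * l) <= B * modulus h ^+ 2) ->
  is_derive z 1 F l.
Proof.
move=> HB.
have cv : (fun h => h^-1 *: (F (h *: (1 : Cplx R) + z) - F z)) @ 0^' --> l.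
  apply/cvgrPdist_lt => e e0.
  (* A positive element for the order of [Cplx R] has imaginary part 0, so the tolerance may be
     taken in [R]. *)
  have [d d0 ed] : exists2 d : R, 0 < d & e = rc d.
    case: e e0 => a b; rewrite ltcE /= => /andP[/eqP -> a0].
    by exists a.
  have B1 : 0 < `|B| + 1 by rewrite ltr_wpDl.
  exists (rc (Num.min 2^-1 (d / (`|B| + 1)))).
    by rewrite -rc0 /= ltr_rc lt_min invr_gt0 ltr0n divr_gt0.
  move=> h /= hd h0.
  move: hd; rewrite normE ltr_rc sub0r modulusN lt_min => /andP[h1 h2].
  rewrite normE ed ltr_rc.
  have hp : 0 < modulus h by rewrite modulus_gt0.
  have -> : l - h^-1 *: (F (h *: (1 : Cplx R) + z) - F z) =
            - (h^-1 * (F (z + h) - F z - h * l)).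
    change (l - h^-1 * (F (h * 1 + z) - F z) = - (h^-1 * (F (z + h) - F z - h * l))).
    rewrite mulr1 [h + z]addrC [in RHS]mulrBr [h^-1 * (h * l)]mulrA mulVf// mul1r.
    by rewrite opprB.
  rewrite modulusN modulusM modulusV mulrC ltr_pdivrMr//.
  apply: le_lt_trans (HB _ (ltW h1)) _.
  rewrite expr2 mulrA ltr_pM2r//.
  apply: le_lt_trans (_ : (`|B| + 1) * modulus h < d).
    rewrite ler_pM2r//; have := ler_norm B; lra.
  by rewrite mulrC -ltr_pdivlMr.
by split; [apply/cvg_ex; exists l | apply/cvg_lim].
Qed.
End Modulus.

(** * Power series with real coefficients *)

Section PowerSeries.
Variable R : realType.
Implicit Types (z w : Cplx R) (a b : nat -> R).

(** Absolute convergence at every radius, expressed by bounded partial sums: the bound [K] is what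
    the later estimates use, and it passes to dominated sequences term by term. *)
Definition entire_coef a := forall r : R, 0 <= r ->
  exists K : R, forall n, \sum_(j < n) `|a j| * r ^+ j <= K.

Definition psum a n z : Cplx R := \sum_(j < n) rc (a j) * z ^+ j.

(* Locked: otherwise ring and lra compare atoms by unfolding the limits. *)
Fact pser_key : unit. Proof. by []. Qed.
Definition pser : (nat -> R) -> Cplx R -> Cplx R :=
  locked_with pser_key (fun a z =>
    limn (fun n => complex.Re (psum a n z)) +i* limn (fun n => complex.Im (psum a n z))).

Lemma Re_pser a z : complex.Re (pser a z) = limn (fun n => complex.Re (psum a n z)).
Proof. by rewrite /pser unlock. Qed.
Lemma Im_pser a z : complex.Im (pser a z) = limn (fun n => complex.Im (psum a n z)).
Proof. by rewrite /pser unlock. Qed.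

Lemma psum0 a z : psum a 0 z = 0. Proof. by rewrite /psum big_ord0. Qed.

Lemma psumSr a n z : psum a n.+1 z = psum a n z + rc (a n) * z ^+ n.
Proof. by rewrite /psum big_ord_recr. Qed.

Lemma psumS a n z :
  psum a n.+1 z = rc (a 0%N) + z * psum (fun j => a j.+1) n z.
Proof.
rewrite /psum big_ord_recl expr0 mulr1 mulr_sumr; congr (_ + _).
by apply: eq_bigr => i _; rewrite exprS mulrCA.
Qed.

Lemma dominated_series_cvg (u : nat -> R) (v : nat -> R) (K : R) :
  (forall j, `|u j| <= v j) -> (forall n, \sum_(j < n) v j <= K) ->
  cvgn (fun n => \sum_(j < n) u j).
Proof.
move=> uv vK.
have v0 j : 0 <= v j by apply: le_trans (uv j).
have -> : (fun n => \sum_(j < n) u j) = series u.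
  by apply/funext => n; rewrite seriesEord.
apply: normed_cvg.
apply: (@series_le_cvg _ _ v) => [n|n|n|] //=.
apply: nondecreasing_is_cvgn.
  by apply: nondecreasing_series => n _ _.
by exists K => _ [n _ <-]; rewrite seriesEord vK.
Qed.

Lemma psum_Re_cvg a z : entire_coef a -> cvgn (fun n => complex.Re (psum a n z)).
Proof.
move=> ea; have [K HK] := ea _ (modulus_ge0 z).
have -> : (fun n => complex.Re (psum a n z)) =
          (fun n => \sum_(j < n) (a j * complex.Re (z ^+ j))).
  by apply/funext => n; rewrite Re_sum; apply: eq_bigr => i _; rewrite Re_rcM.
refine (@dominated_series_cvg (fun j => a j * complex.Re (z ^+ j))
  (fun j => `|a j| * modulus z ^+ j) K _ HK) => j.
by rewrite normrM -modulusX ler_wpM2l// ler_Re_modulus.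
Qed.

Lemma psum_Im_cvg a z : entire_coef a -> cvgn (fun n => complex.Im (psum a n z)).
Proof.
move=> ea; have [K HK] := ea _ (modulus_ge0 z).
have -> : (fun n => complex.Im (psum a n z)) =
          (fun n => \sum_(j < n) (a j * complex.Im (z ^+ j))).
  by apply/funext => n; rewrite Im_sum; apply: eq_bigr => i _; rewrite Im_rcM.
refine (@dominated_series_cvg (fun j => a j * complex.Im (z ^+ j))
  (fun j => `|a j| * modulus z ^+ j) K _ HK) => j.
by rewrite normrM -modulusX ler_wpM2l// ler_Im_modulus.
Qed.

Lemma pser_approx a z (e : R) : entire_coef a -> 0 < e ->
  exists N0, forall n, (N0 <= n)%N -> modulus (pser a z - psum a n z) < e.
Proof.
move=> ea e0.
have e20 : 0 < e / 2 by rewrite divr_gt0.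
have /cvgrPdist_lt /(_ _ e20) [N1 _ H1] := psum_Re_cvg (z:=z) ea.
have /cvgrPdist_lt /(_ _ e20) [N2 _ H2] := psum_Im_cvg (z:=z) ea.
exists (maxn N1 N2) => n; rewrite geq_max => /andP[n1 n2].
apply: le_lt_trans (modulus_le_ReIm _) _.
rewrite ReD ImD ReN ImN Re_pser Im_pser.
have := H1 n n1; have := H2 n n2; rewrite /=; lra.
Qed.

Lemma pser_unique a z w : entire_coef a ->
  (forall e : R, 0 < e -> exists N0, forall n, (N0 <= n)%N ->
     modulus (w - psum a n z) < e) -> pser a z = w.
Proof.
move=> ea H; apply/eqP; rewrite -subr_eq0 -modulus_eq0 eq_le modulus_ge0 andbT.
apply/ler_addgt0Pr => e e0; rewrite add0r.
have e20 : 0 < e / 2 by rewrite divr_gt0.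
have [N1 H1] := H _ e20.
have [N2 H2] := pser_approx z ea e20.
have := H1 _ (leq_maxl N1 N2); have := H2 _ (leq_maxr N1 N2).
set n := maxn _ _ => h2 h1.
have -> : pser a z - w = (pser a z - psum a n z) - (w - psum a n z) by ring.
apply: le_trans (modulusB _ _) _; lra.
Qed.

Lemma pser_le_lim a z w (K : R) : entire_coef a ->
  (exists N0, forall n, (N0 <= n)%N -> modulus (w + psum a n z) <= K) ->
  modulus (w + pser a z) <= K.
Proof.
move=> ea [N0 H]; apply/ler_addgt0Pr => e e0.
have [N2 H2] := pser_approx z ea e0.
have := H _ (leq_maxl N0 N2); have := H2 _ (leq_maxr N0 N2).
set n := maxn _ _ => h2 h1.
have -> : w + pser a z = (w + psum a n z) + (pser a z - psum a n z) by ring.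
apply: le_trans (modulusD _ _) _; lra.
Qed.

Lemma entire_coef_le a b (K : R) : (forall j, `|a j| <= K * `|b j|) ->
  entire_coef b -> entire_coef a.
Proof.
move=> ab eb r r0; have [M HM] := eb r r0.
exists (`|K| * M) => n.
apply: le_trans (_ : `|K| * (\sum_(j < n) `|b j| * r ^+ j) <= _); last first.
  by rewrite ler_wpM2l.
rewrite mulr_sumr ler_sum// => j _; rewrite mulrA ler_wpM2r ?exprn_ge0//.
by apply: le_trans (ab j) _; rewrite ler_wpM2r// ler_norm.
Qed.

Lemma entire_coefD a b : entire_coef a -> entire_coef b ->
  entire_coef (fun j => a j + b j).
Proof.
move=> ea eb r r0; have [M HM] := ea r r0; have [K HK] := eb r r0.
exists (M + K) => n.
apply: le_trans (lerD (HM n) (HK n)); rewrite -big_split /= ler_sum// => j _.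
by rewrite -mulrDl ler_wpM2r ?exprn_ge0// ler_normD.
Qed.

Lemma entire_coef_scale a (q : R) : entire_coef a ->
  entire_coef (fun j => q ^+ j * a j).
Proof.
move=> ea r r0; have [|M HM] := ea (`|q| * r); first by rewrite mulr_ge0.
exists M => n; apply: le_trans (HM n); rewrite ler_sum// => j _.
by rewrite normrM normrX exprMn [`|q| ^+ j * _]mulrC mulrA.
Qed.

Lemma entire_coefS a : entire_coef a -> entire_coef (fun j => a j.+1).
Proof.
move=> ea r r0; have [|M HM] := ea (r + 1); first by rewrite addr_ge0.
exists M => n; apply: le_trans (HM n.+1).
rewrite big_ord_recl expr0 mulr1 -[leLHS]add0r lerD// ler_sum// => j _.
rewrite ler_wpM2l// lift0 exprS.
apply: le_trans (_ : (r + 1) ^+ j <= _).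
  by rewrite exprn_mono// lerDl.
by rewrite ler_peMl ?exprn_ge0 ?addr_ge0// lerDr.
Qed.

Definition deriv_coef a j := j.+1%:R * a j.+1.

(** Summability at radius [2 * (r + 1)] pays for both losses: 2^(j+1) exceeds j + 1, and (r +
    1)^(j+1) is at least r^j. *)
Lemma entire_coef_deriv a : entire_coef a -> entire_coef (deriv_coef a).
Proof.
move=> ea r r0; have [|M HM] := ea (2 * (r + 1)); first by rewrite mulr_ge0 ?addr_ge0.
exists M => n; apply: le_trans (HM n.+1).
rewrite big_ord_recl expr0 mulr1 -[leLHS]add0r lerD// ler_sum// => j _.
rewrite /deriv_coef normrM mulrAC mulrC ler_wpM2l// lift0 exprMn.
apply: ler_pM; rewrite ?normr_ge0 ?exprn_ge0//.
  by rewrite normr_nat -natrX ler_nat ltnW// ltn_expl.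
apply: le_trans (_ : (r + 1) ^+ j <= _).
  by rewrite exprn_mono// lerDl.
by rewrite exprS ler_peMl ?exprn_ge0 ?addr_ge0// lerDr.
Qed.

(* The quantity S_n + 2 |a_n| r^n is nonincreasing for n >= J. *)
Lemma entire_coef_ratio a :
  (forall r : R, 0 < r -> exists J, forall j, (J <= j)%N ->
     `|a j.+1| * r <= `|a j| / 2) -> entire_coef a.
Proof.
move=> H r0 r00; set r := r0 + 1.
have rp : 0 < r by rewrite ltr_wpDl.
have [J HJ] := H r rp.
pose S n := \sum_(j < n) `|a j| * r ^+ j.
have Sinc n : S n <= S n.+1.
  by rewrite /S big_ord_recr /= lerDl mulr_ge0 ?exprn_ge0// ltW.
have HS k : S (J + k)%N + 2 * (`|a (J + k)%N| * r ^+ (J + k)) <= S J + 2 * (`|a J| * r ^+ J).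
  elim: k => [|k IH]; first by rewrite !addn0.
  apply: le_trans IH; rewrite addnS {1}/S big_ord_recr /= -/(S _).
  have := ler_wpM2r (exprn_ge0 (J + k) (ltW rp)) (HJ _ (leq_addr k J)).
  rewrite exprS; lra.
exists (S J + 2 * (`|a J| * r ^+ J)) => n.
apply: le_trans (_ : S n <= _).
  rewrite ler_sum// => j _; rewrite ler_wpM2l// exprn_mono//.
  by rewrite lerDl.
apply: le_trans (_ : S (J + n)%N <= _).
  by elim: (J) => [|i IHi]; [rewrite add0n|rewrite addSn (le_trans IHi)].
apply: le_trans (HS n); rewrite lerDl mulr_ge0// mulr_ge0// exprn_ge0//.
exact: ltW.
Qed.

Lemma pserD a b z : entire_coef a -> entire_coef b ->
  pser (fun j => a j + b j) z = pser a z + pser b z.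
Proof.
move=> ea eb; apply: pser_unique; first exact: entire_coefD.
move=> e e0; have e20 : 0 < e / 2 by rewrite divr_gt0.
have [N1 H1] := pser_approx z ea e20.
have [N2 H2] := pser_approx z eb e20.
exists (maxn N1 N2) => n; rewrite geq_max => /andP[n1 n2].
have -> : psum (fun j => a j + b j) n z = psum a n z + psum b n z.
  by rewrite /psum -big_split; apply: eq_bigr => j _; rewrite rcD mulrDl.
have -> : pser a z + pser b z - (psum a n z + psum b n z) =
  (pser a z - psum a n z) + (pser b z - psum b n z) by ring.
apply: le_lt_trans (modulusD _ _) _.
have := H1 _ n1; have := H2 _ n2; lra.
Qed.

Lemma pserS a z : entire_coef a ->
  pser a z = rc (a 0%N) + z * pser (fun j => a j.+1) z.
Proof.
move=> ea; apply: pser_unique => // e e0.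
have zp : 0 < modulus z + 1 by rewrite ltr_wpDl// modulus_ge0.
have [|N1 H1] := pser_approx (e := e / (modulus z + 1)) z (entire_coefS ea).
  by rewrite divr_gt0.
exists N1.+1 => -[//|n] n1; rewrite psumS.
set x := pser _ _; set y := psum _ _ _.
have -> : rc (a 0%N) + z * x - (rc (a 0%N) + z * y) = z * (x - y) by ring.
rewrite modulusM; have := H1 n n1; rewrite ltr_pdivlMr// -/x -/y.
apply: le_lt_trans; rewrite mulrC ler_wpM2l ?modulus_ge0//.
by rewrite lerDl.
Qed.

Lemma pser_scale a (q : R) z : entire_coef a ->
  pser (fun j => q ^+ j * a j) z = pser a (rc q * z).
Proof.
move=> ea; apply: pser_unique; first exact: entire_coef_scale.
move=> e e0; have [N1 H1] := pser_approx (rc q * z) ea e0.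
exists N1 => n n1.
have -> : psum (fun j => q ^+ j * a j) n z = psum a n (rc q * z).
  by apply: eq_bigr => j _; rewrite rcM rcX exprMn mulrAC [RHS]mulrC.
exact: H1.
Qed.

Lemma pser_bound a z (r K : R) : entire_coef a -> modulus z <= r ->
  (forall n, \sum_(j < n) `|a j| * r ^+ j <= K) -> modulus (pser a z) <= K.
Proof.
move=> ea zr HK; rewrite -[pser a z]add0r; apply: pser_le_lim => //.
exists 0%N => n _; rewrite add0r; apply: le_trans (HK n).
apply: le_trans (modulus_sum _) _; apply: ler_sum => j _.
by rewrite modulusM modulus_rc modulusX ler_wpM2l// exprn_mono// modulus_ge0.
Qed.

(** The second-order remainder of z^j is at most |h|^2 (4r)^j. Summed against the coefficients at
    radius [4 * r], this gives a quadratic remainder for all partial sums with one constant [K],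
    which survives the passage to the limit. *)
Lemma pser_deriv a z : entire_coef a ->
  is_derive z 1 (pser a) (pser (deriv_coef a) z).
Proof.
move=> ea; set r := modulus z + 1.
have r1 : 1 <= r by rewrite lerDr modulus_ge0.
have r0 : 0 <= r by rewrite (le_trans _ r1).
have [|K HK] := ea (4 * r); first by rewrite mulr_ge0.
apply: (@is_derive_quadratic _ _ _ _ K) => h h2'.
have h1 : modulus h <= 1 by apply: le_trans h2' _; rewrite invf_le1// ler1n.
have zr : modulus z <= r by rewrite lerDl.
have zhr : modulus (z + h) <= r.
  by apply: le_trans (modulusD _ _) _; rewrite lerD2l.
pose e j := (z + h) ^+ j - z ^+ j - h * (j%:R * z ^+ j.-1).
(* This recursion makes the bound on [e j] an induction; the base [4 * r] has room for the factor j,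
   absorbed by a power of 2, and for the sum of the two terms. *)
have eS j : e j.+1 = (z + h) * e j + h ^+ 2 * (j%:R * z ^+ j.-1).
  rewrite /e; case: j => [|j] /=; first by rewrite !expr0 expr1; ring.
  by rewrite -!natr1 !exprS; ring.
have He j : modulus (e j) <= modulus h ^+ 2 * (4 * r) ^+ j.
  elim: j => [|j IH].
    rewrite /e !expr0 mul0r mulr0 subr0 subrr modulus0 mulr1.
    by rewrite exprn_ge0// modulus_ge0.
  rewrite eS; apply: le_trans (modulusD _ _) _.
  rewrite [modulus ((z + h) * _)]modulusM [modulus (h ^+ 2 * _)]modulusM modulusX.
  rewrite [modulus (j%:R * _)]modulusM [modulus (z ^+ _)]modulusX.
  have H1 : modulus (z + h) * modulus (e j) <= modulus h ^+ 2 * (r * (4 * r) ^+ j).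
    apply: le_trans (ler_pM (modulus_ge0 _) (modulus_ge0 _) zhr IH) _.
    by rewrite mulrCA.
  have H2 : modulus (j%:R : Cplx R) * modulus z ^+ j.-1 <= (4 * r) ^+ j.
    have -> : modulus (j%:R : Cplx R) = j%:R.
      have -> : (j%:R : Cplx R) = rc j%:R by rewrite /rc rmorph_nat.
      by rewrite modulus_rc normr_nat.
    case: j {IH H1} => [|j]; first by rewrite mul0r expr0 ler01.
    rewrite exprMn; apply: ler_pM; rewrite ?exprn_ge0 ?modulus_ge0//=.
      by rewrite -natrX ler_nat ltnW// ltn_expl.
    apply: le_trans (_ : r ^+ j <= _).
      by rewrite exprn_mono// modulus_ge0.
    by rewrite exprS ler_peMl ?exprn_ge0.
  have H3 : (4 * r) ^+ j <= r * (4 * r) ^+ j.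
    by rewrite ler_peMl ?exprn_ge0 ?mulr_ge0.
  have H4 := ler_wpM2l (exprn_ge0 2 (modulus_ge0 h)) (le_trans H2 H3).
  rewrite [(4 * r) ^+ j.+1]exprS -[4 * r * _]mulrA.
  have := mulr_ge0 (exprn_ge0 2 (modulus_ge0 h)) (mulr_ge0 r0 (exprn_ge0 j (mulr_ge0 (ler0n R 4) r0))).
  lra.
have Hn n : modulus (psum a n.+1 (z + h) - psum a n.+1 z - h * psum (deriv_coef a) n z)
     <= K * modulus h ^+ 2.
  have -> : psum a n.+1 (z + h) - psum a n.+1 z - h * psum (deriv_coef a) n z =
     \sum_(j < n.+1) rc (a j) * e j.
    have -> : psum (deriv_coef a) n z = \sum_(j < n.+1) rc (a j) * (j%:R * z ^+ j.-1).
      rewrite big_ord_recl /= mul0r mulr0 add0r; apply: eq_bigr => j _.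
      rewrite /deriv_coef /bump /= rcM.
      have -> : rc (j.+1%:R : R) = j.+1%:R by rewrite /rc rmorph_nat.
      by rewrite mulrAC mulrC.
    rewrite /psum mulr_sumr -!sumrB; apply: eq_bigr => j _.
    by rewrite /e; ring.
  apply: le_trans (modulus_sum _) _.
  apply: le_trans (_ : modulus h ^+ 2 * (\sum_(j < n.+1) `|a j| * (4 * r) ^+ j) <= _).
    rewrite mulr_sumr; apply: ler_sum => j _.
    by rewrite modulusM modulus_rc mulrCA ler_wpM2l.
  by rewrite mulrC ler_wpM2r// exprn_ge0 ?modulus_ge0.
apply/ler_addgt0Pr => d d0.
have d40 : 0 < d / 3 by rewrite divr_gt0.
have [N1 H1] := pser_approx (z + h) ea d40.
have [N2 H2] := pser_approx z ea d40.
have [N3 H3] := pser_approx z (entire_coef_deriv ea) d40.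
pose n := maxn N1 (maxn N2 N3).
have n1 : (N1 <= n.+1)%N by rewrite leqW// leq_maxl.
have n2 : (N2 <= n.+1)%N by rewrite leqW// /n !leq_max leqnn orbT.
have n3 : (N3 <= n)%N by rewrite /n !leq_max leqnn !orbT.
have := H1 _ n1; have := H2 _ n2; have := H3 _ n3; have := Hn n.
set A := pser a (z + h); set A' := psum _ _ (z + h).
set B := pser a z; set B' := psum a _ z.
set D := pser _ z; set D' := psum _ _ z.
move=> h5 h4 h3 h2; clearbody A A' B B' D D'.
have -> : A - B - h * D =
  (A' - B' - h * D') + (A - A') - (B - B') - h * (D - D') by ring.
apply: le_trans (modulus_add4 _ _ _ _) _.
have : modulus (h * (D - D')) <= modulus (D - D').
  by rewrite modulusM ler_piMl ?modulus_ge0.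
move: h2 h3 h4 h5; move: (modulus (A - A')) (modulus (B - B')) (modulus (D - D')).
move: (modulus (h * (D - D'))) (modulus (A' - B' - h * D')) (K * modulus h ^+ 2).
move=> x1 x2 x3 x4 x5 x6; clear; lra.
Qed.

Lemma pserZ a (c : R) z : entire_coef a ->
  pser (fun j => c * a j) z = rc c * pser a z.
Proof.
move=> ea; apply: pser_unique.
  by apply: (@entire_coef_le _ a `|c|) => // j; rewrite normrM.
move=> e e0.
have cp : 0 < `|c| + 1 by rewrite ltr_wpDl.
have [|N1 H1] := pser_approx (e := e / (`|c| + 1)) z ea.
  by rewrite divr_gt0.
exists N1 => n n1.
have -> : psum (fun j => c * a j) n z = rc c * psum a n z.
  by rewrite /psum mulr_sumr; apply: eq_bigr => j _; rewrite rcM mulrA.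
rewrite -mulrBr modulusM modulus_rc.
have := H1 n n1; rewrite ltr_pdivlMr//; apply: le_lt_trans.
by rewrite mulrC ler_wpM2l ?modulus_ge0// lerDl.
Qed.

(** Reads an identity A(z) = B(z) + z C(z) off the coefficients. The functional equations of f, f',
    f'', P and N are all brought to this shape, with 1 + z split into 1 and z. *)
Lemma pser_eq_shift a b c z : entire_coef a -> entire_coef b -> entire_coef c ->
  a 0%N = b 0%N -> (forall j, a j.+1 = b j.+1 + c j) ->
  pser a z = pser b z + z * pser c z.
Proof.
move=> ea eb ec h0 hS; rewrite (pserS z ea) (pserS z eb) h0.
have -> : (fun j => a j.+1) = (fun j => b j.+1 + c j) by apply/funext.
by rewrite (pserD z (entire_coefS eb) ec) mulrDr addrA.
Qed.

(** For nonnegative coefficients and x >= 0 this is the maximum modulus on the circle of radius x,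
    so growth is studied on a real function. *)
Definition pser_real a (x : R) : R := complex.Re (pser a (rc x)).

Lemma psum_real a n x : psum a n (rc x) = rc (\sum_(j < n) a j * x ^+ j).
Proof.
elim: n => [|n IH]; first by rewrite psum0 big_ord0.
by rewrite psumSr IH big_ord_recr /= rcD rcM rcX.
Qed.

Lemma pser_realE a x : entire_coef a -> pser a (rc x) = rc (pser_real a x).
Proof.
move=> ea; apply/eqP; rewrite eq_complex /pser_real eqxx /= Im_pser; apply/eqP.
by apply: lim_near_cst => //; exists 0%N => // n _; rewrite psum_real.
Qed.

Section NonnegativeCoefficients.
Variable a : nat -> R.
Hypotheses (a0 : forall j, 0 <= a j) (ea : entire_coef a).

Lemma psum_le_pser_real n x : 0 <= x -> \sum_(j < n) a j * x ^+ j <= pser_real a x.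
Proof.
move=> x0; rewrite /pser_real Re_pser.
have := psum_Re_cvg (z := rc x) ea.
have E : (fun n => complex.Re (psum a n (rc x))) = (fun n => \sum_(j < n) a j * x ^+ j).
  by apply/funext => k; rewrite psum_real.
rewrite E => cv.
apply: (@nondecreasing_cvgn_le _ (fun n => \sum_(j < n) a j * x ^+ j)) => //.
apply/nondecreasing_seqP => k; rewrite big_ord_recr /= lerDl.
by rewrite mulr_ge0 ?exprn_ge0.
Qed.

Lemma modulus_pser_le z : modulus (pser a z) <= pser_real a (modulus z).
Proof.
apply: (pser_bound ea (lexx _)) => n.
rewrite (eq_bigr (fun j : 'I_n => a j * modulus z ^+ j)).
  by rewrite psum_le_pser_real// modulus_ge0.
by move=> j _; rewrite ger0_norm.
Qed.

Lemma modulus_pser_dominated b (K : R) z : 0 <= K ->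
  (forall j, `|b j| <= K * a j) ->
  modulus (pser b z) <= K * pser_real a (modulus z).
Proof.
move=> K0 ba.
have eb : entire_coef b.
  by apply: (@entire_coef_le _ a K) => // j; rewrite [`|a j|]ger0_norm.
apply: (pser_bound eb (lexx _)) => n.
apply: le_trans (_ : K * (\sum_(j < n) a j * modulus z ^+ j) <= _); last first.
  by rewrite ler_wpM2l// psum_le_pser_real// modulus_ge0.
rewrite mulr_sumr; apply: ler_sum => j _.
by rewrite mulrA ler_wpM2r ?exprn_ge0 ?modulus_ge0.
Qed.

Lemma pser_real_ge0 x : 0 <= x -> 0 <= pser_real a x.
Proof. by move=> x0; have := psum_le_pser_real 0 x0; rewrite big_ord0. Qed.

Lemma pser_real_mono x y : 0 <= x -> x <= y -> pser_real a x <= pser_real a y.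
Proof.
move=> x0 xy.
have -> : pser_real a x = modulus (pser a (rc x)).
  by rewrite pser_realE// modulus_rc ger0_norm// pser_real_ge0.
have y0 := le_trans x0 xy.
apply: (pser_bound ea (r := y)); first by rewrite modulus_rc ger0_norm.
move=> n; rewrite (eq_bigr (fun j : 'I_n => a j * y ^+ j)).
  by rewrite psum_le_pser_real.
by move=> j _; rewrite ger0_norm.
Qed.

Lemma deriv_coef_ge0 j : 0 <= deriv_coef a j.
Proof. by rewrite mulr_ge0. Qed.

(** Term by term, j + 1 <= 2^(j+1) and x^j <= x^(j+1). Doubling the argument costs little for a
    function whose logarithm grows like (log x)^2. *)
Lemma pser_real_deriv_le x : 1 <= x ->
  pser_real (deriv_coef a) x <= pser_real a (2 * x).
Proof.
move=> x1; have x0 : 0 <= x by apply: le_trans x1.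
have e' := entire_coef_deriv ea.
apply: le_trans (ler_norm _) _; rewrite -modulus_rc -pser_realE//.
apply: (pser_bound e' (r := x)); first by rewrite modulus_rc ger0_norm.
move=> n; apply: le_trans (psum_le_pser_real n.+1 _); last by rewrite mulr_ge0.
rewrite big_ord_recl expr0 mulr1 -[leLHS]add0r lerD// ler_sum// => j _.
rewrite ger0_norm ?deriv_coef_ge0// /deriv_coef mulrAC mulrC ler_wpM2l//.
rewrite lift0 exprMn ler_pM ?exprn_ge0//.
  by rewrite -natrX ler_nat ltnW// ltn_expl.
by rewrite exprS ler_peMl ?exprn_ge0.
Qed.
End NonnegativeCoefficients.
End PowerSeries.

(** * The q-exponential and a Bezout identity *)

Section QExponential.
Variable R : realType.
Implicit Types z : Cplx R.

(** A small ratio separates the zeros: for 16^m <= |z| <= 16^(m+1) only the factors 1 + q^k z with k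
    = m and k = m + 1 can be small. Those with smaller k have modulus at least 15, those with larger
    k at least 15/16. *)
Definition q : R := 16^-1.

Lemma q_gt0 : 0 < q. Proof. by rewrite invr_gt0. Qed.
Lemma q_lt1 : q < 1. Proof. rewrite /q; lra. Qed.
Lemma qX_gt0 n : 0 < q ^+ n. Proof. by rewrite exprn_gt0// q_gt0. Qed.
Lemma qX_le1 n : q ^+ n <= 1.
Proof. by rewrite exprn_ile1// ltW// ?q_gt0// q_lt1. Qed.
Lemma qXS_le n : q ^+ n.+1 <= q.
Proof. by rewrite exprS ler_piMr// ?qX_le1// ltW// q_gt0. Qed.
Lemma qXS_le15 n : 15 / 16 <= 1 - q ^+ n.+1.
Proof. by have := qXS_le n; rewrite {2}/q; lra. Qed.

Lemma natr_qX_le1 n : n.+1%:R * q ^+ n <= 1.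
Proof.
rewrite /q exprVn ler_pdivrMr ?exprn_gt0// mul1r -natrX ler_nat.
exact: ltn_expl.
Qed.

Lemma qX_small (x : R) : 0 < x -> exists J, forall j, (J <= j)%N -> q ^+ j < x.
Proof.
move=> x0; exists (Num.bound x^-1) => j Jj.
have := archi_boundP (ltW (_ : 0 < x^-1)); rewrite invr_gt0 => /(_ x0) H.
have /(_ j) := natr_qX_le1.
rewrite mulrC -ler_pdivlMr ?ltr0n// div1r => /le_lt_trans; apply.
rewrite invf_plt ?posrE ?ltr0n//; apply: lt_le_trans H _.
by rewrite ler_nat leqW.
Qed.

(** Euler's expansion of the product: the coefficient is q^(n(n-1)/2) / ((1-q)...(1-q^n)). The
    infinite product itself is never formed; [fserE] takes its place. *)
Fixpoint fcoef n : R :=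
  if n is m.+1 then fcoef m * q ^+ m / (1 - q ^+ m.+1) else 1.

Lemma qXS_neq1 n : 1 - q ^+ n.+1 != 0.
Proof. by rewrite gt_eqF//; have := qXS_le15 n; lra. Qed.

Lemma fcoefS n : (1 - q ^+ n.+1) * fcoef n.+1 = q ^+ n * fcoef n.
Proof. by rewrite [fcoef n.+1]/= mulrC mulfVK ?qXS_neq1// mulrC. Qed.

Lemma fcoef_gt0 n : 0 < fcoef n.
Proof.
elim: n => [|n IH] //=; rewrite divr_gt0 ?mulr_gt0 ?qX_gt0//.
by have := qXS_le15 n; lra.
Qed.
Lemma fcoef_ge0 n : 0 <= fcoef n. Proof. exact/ltW/fcoef_gt0. Qed.

Lemma entire_fcoef : entire_coef fcoef.
Proof.
apply: entire_coef_ratio => r r0.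
have [|J HJ] := qX_small (x := (4 * r)^-1); first by rewrite invr_gt0 mulr_gt0.
exists J => j /HJ; rewrite -div1r ltr_pdivlMr ?mulr_gt0// => h.
rewrite !gtr0_norm ?fcoef_gt0//.
have h1 := fcoefS j; have h2 := qXS_le15 j; have h3 := fcoef_gt0 j.
have h4 := fcoef_gt0 j.+1.
have : (15 / 16) * fcoef j.+1 <= q ^+ j * fcoef j by rewrite -h1 ler_pM2r.
move=> h5.
have h6 : (15 / 16) * fcoef j.+1 * r <= q ^+ j * fcoef j * r by rewrite ler_pM2r.
have h7 : q ^+ j * (4 * r) * fcoef j <= 1 * fcoef j by rewrite ler_pM2r// ltW.
rewrite mul1r in h7; lra.
Qed.

(** This is q^(n(n-1)/2), the summing factor of x_i = q^i (b_i - x_(i+1)): multiplication by (-1)^i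
    [tri i] makes that recursion telescope. *)
Fixpoint tri n : R := if n is m.+1 then tri m * q ^+ m else 1.

Lemma tri_gt0 n : 0 < tri n.
Proof. by elim: n => [|n IH] //=; rewrite mulr_gt0// qX_gt0. Qed.

(** The subtracted term closes the induction, because from index 1 on [tri] shrinks at least by 16
    at each step. The factor 3 leaves room for [tri 0 = tri 1 = 1]. *)
Lemma tri_sum i n : \sum_(i <= k < i + n.+1) tri k <= 3 * tri i - 2 * tri (i + n.+1)%N.
Proof.
elim: n => [|n IH].
  rewrite addn1 big_nat1 /=.
  have := ler_wpM2l (ltW (tri_gt0 i)) (qX_le1 i); rewrite mulr1; lra.
rewrite addnS big_nat_recr /=; last by rewrite leq_addr.
have : tri (i + n.+1)%N * q ^+ (i + n.+1) <= tri (i + n.+1)%N / 16.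
  by rewrite ler_pM2l ?tri_gt0// addnS; exact: qXS_le.
have := tri_gt0 (i + n.+1)%N; lra.
Qed.

(* The recursion determines x_i through the tails of an alternating series:
   x_i = (-1)^i / t_i * sum_(k >= i) (-1)^k t_(k+1) b_k, with t = tri. *)
Lemma backward_recursion (b : nat -> R) (beta : R) :
  (forall i, q ^+ i * `|b i| <= beta) ->
  exists x : nat -> R, (forall i, x i = q ^+ i * (b i - x i.+1)) /\
                       (forall i, `|x i| <= 3 * beta).
Proof.
move=> Hb.
have beta0 : 0 <= beta by apply: le_trans (Hb 0%N); rewrite mulr_ge0.
pose d k := (-1) ^+ k * tri k.+1 * b k.
have Hd k : `|d k| <= tri k * beta.
  rewrite /d !normrM normrX normrN1 expr1n mul1r (gtr0_norm (tri_gt0 _)) /= -mulrA.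
  by rewrite (gtr0_norm (qX_gt0 _)) ler_pM2l ?tri_gt0//; exact: Hb.
pose S n := \sum_(k < n) d k.
have cvS : cvgn S.
  refine (@dominated_series_cvg R d (fun k => tri k * beta) (3 * beta) Hd _).
  case=> [|n]; first by rewrite big_ord0 mulr_ge0.
  rewrite -mulr_suml ler_wpM2r//.
  have := tri_sum 0 n; rewrite add0n big_mkord => /le_trans; apply.
  rewrite mulr1 lerBlDr lerDl mulr_ge0// ltW// tri_gt0//.
have tail i n : `|S (i + n)%N - S i| <= 3 * beta * tri i.
  case: n => [|n].
    by rewrite addn0 subrr normr0 !mulr_ge0// ltW// tri_gt0.
  have -> : S (i + n.+1)%N - S i = \sum_(i <= k < i + n.+1) d k.
    apply/eqP; rewrite subr_eq addrC /S -!(big_mkord xpredT d).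
    by rewrite -big_cat_nat //= leq_addr.
  apply: le_trans (ler_norm_sum _ _ _) _.
  apply: le_trans (ler_sum _ (fun k _ => Hd k)) _.
  rewrite -mulr_suml mulrAC ler_wpM2r//.
  have := tri_sum i n; have := tri_gt0 (i + n.+1)%N; lra.
pose y i := limn S - S i.
have Hy i : `|y i| <= 3 * beta * tri i.
  apply/ler_addgt0Pr => e e0.
  have /cvgrPdist_lt /(_ _ e0) [m _ Hm] := cvS.
  have := Hm (i + m)%N (leq_addl _ _) => /= h.
  have -> : y i = (limn S - S (i + m)%N) + (S (i + m)%N - S i) by rewrite /y; ring.
  apply: le_trans (ler_normD _ _) _; have := tail i m; lra.
exists (fun i => (-1) ^+ i * y i / tri i); split => i; last first.
  rewrite !normrM normrX normrN1 expr1n mul1r normfV (gtr0_norm (tri_gt0 i)).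
  by rewrite ler_pdivrMr ?tri_gt0.
(* Splitting off the first term of the tail is already the recursion, up to division by (-1)^i
   [tri i]. *)
have yE : y i = d i + y i.+1 by rewrite /y /S big_ord_recr /=; ring.
rewrite yE /d exprS /=.
have s2 : (-1) ^+ i * (-1) ^+ i = 1 :> R by rewrite -expr2 sqrr_sign.
set s := (-1) ^+ i in s2 *.
have t0 : tri i != 0 by rewrite gt_eqF// tri_gt0.
have q0 : q ^+ i != 0 by rewrite gt_eqF// qX_gt0.
rewrite mulrDr !mulrA s2; field.
by rewrite t0 q0.
Qed.

(* The recursions for pcoef and ncoef amount to the functional equations PserE
   and NserE, which make bezout invariant under z -> qz. *)
Lemma pcoef_spec : exists x : nat -> R,
  (forall i, x i = q ^+ i * (1 - x i.+1)) /\ (forall i, `|x i| <= 3).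
Proof.
have [|x [H1 H2]] := @backward_recursion (fun=> 1) 1.
  by move=> i; rewrite normr1 mulr1 qX_le1.
by exists x; split=> // i; have := H2 i; rewrite mulr1.
Qed.

Definition pcoef := projT1 (cid pcoef_spec).

Lemma pcoefE i : pcoef i = q ^+ i * (1 - pcoef i.+1).
Proof. exact: (proj1 (projT2 (cid pcoef_spec))). Qed.

Lemma pcoef_bound i : `|pcoef i| <= 3.
Proof. exact: (proj2 (projT2 (cid pcoef_spec))). Qed.

Lemma ncoef_spec : exists x : nat -> R,
  (forall i, x i = q ^+ i * (i.+1%:R - pcoef i.+1 - x i.+1)) /\
  (forall i, `|x i| <= 12).
Proof.
have [|x [H1 H2]] := @backward_recursion (fun i => i.+1%:R - pcoef i.+1) 4.
  move=> i; have := ler_wpM2l (ltW (qX_gt0 i)) (ler_normB i.+1%:R (pcoef i.+1)).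
  move=> /le_trans; apply; rewrite mulrDr normr_nat.
  have := natr_qX_le1 i; rewrite mulrC => h.
  have := ler_pM (ltW (qX_gt0 i)) (normr_ge0 _) (qX_le1 i) (pcoef_bound i.+1); lra.
by exists x; split=> // i; have := H2 i; lra.
Qed.

Definition ncoef := projT1 (cid ncoef_spec).

Lemma ncoefE i : ncoef i = q ^+ i * (i.+1%:R - pcoef i.+1 - ncoef i.+1).
Proof. exact: (proj1 (projT2 (cid ncoef_spec))). Qed.

Lemma ncoef_bound i : `|ncoef i| <= 12.
Proof. exact: (proj2 (projT2 (cid ncoef_spec))). Qed.

(** The value is close to 1 - 1/16 - 2/16 = 13/16. Unrolling both recursions up to index 3
    multiplies the unknown terms there by at least q^3 in smallness, so the crude bounds 3 and 12
    suffice. *)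
Lemma ncoef0_gt0 : 0 < ncoef 0.
Proof.
have := pcoefE 1; have := pcoefE 2; have := ncoefE 0; have := ncoefE 1.
have := ncoefE 2; have := pcoef_bound 3; have := ncoef_bound 3.
rewrite !ler_norml expr0 expr1 expr2 /q => /andP[h1 h2] /andP[h3 h4]; lra.
Qed.

(** * The series f, P, N, their functional equations and the Bezout identity *)

Definition fser := pser fcoef.
Definition fser1 := pser (deriv_coef fcoef).
Definition fser2 := pser (deriv_coef (deriv_coef fcoef)).
Definition Pser := pser (fun j => pcoef j * fcoef j).
Definition Nser := pser (fun j => ncoef j * fcoef j).

Lemma entire_fcoef1 : entire_coef (deriv_coef fcoef).
Proof. exact/entire_coef_deriv/entire_fcoef. Qed.
Lemma entire_fcoef2 : entire_coef (deriv_coef (deriv_coef fcoef)).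
Proof. exact/entire_coef_deriv/entire_fcoef1. Qed.

Lemma Pcoef_le j : `|pcoef j * fcoef j| <= 3 * fcoef j.
Proof. by rewrite normrM (gtr0_norm (fcoef_gt0 j)) ler_pM2r ?fcoef_gt0// pcoef_bound. Qed.
Lemma Ncoef_le j : `|ncoef j * fcoef j| <= 12 * fcoef j.
Proof. by rewrite normrM (gtr0_norm (fcoef_gt0 j)) ler_pM2r ?fcoef_gt0// ncoef_bound. Qed.

Lemma entire_pcoef : entire_coef (fun j => pcoef j * fcoef j).
Proof.
apply: (@entire_coef_le _ _ fcoef 3) entire_fcoef => j.
by rewrite (gtr0_norm (fcoef_gt0 j)) Pcoef_le.
Qed.
Lemma entire_ncoef : entire_coef (fun j => ncoef j * fcoef j).
Proof.
apply: (@entire_coef_le _ _ fcoef 12) entire_fcoef => j.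
by rewrite (gtr0_norm (fcoef_gt0 j)) Ncoef_le.
Qed.

Local Notation Q := (rc q).

Lemma entire_coefZ (c : R) (a : nat -> R) :
  entire_coef a -> entire_coef (fun j => c * a j).
Proof. by apply: (@entire_coef_le _ _ a `|c|) => j; rewrite normrM. Qed.

(** On coefficients this is [fcoefS]. The zeros, the growth and the lower bounds of f are all
    obtained by iterating it. *)
Lemma fserE z : fser z = (1 + z) * fser (Q * z).
Proof.
have e := entire_coef_scale q entire_fcoef.
rewrite mulrDl mul1r /fser -(pser_scale q z entire_fcoef).
apply: pser_eq_shift => //; first exact: entire_fcoef.
  by rewrite expr0 mul1r.
by move=> j; have := fcoefS j; lra.
Qed.

Lemma fser1E z : fser1 z = fser (Q * z) + Q * (1 + z) * fser1 (Q * z).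
Proof.
have e0 := entire_fcoef; have e1 := entire_fcoef1.
have e0q := entire_coef_scale q e0; have e1q := entire_coef_scale q e1.
have e1qq := entire_coefZ q e1q.
have -> : fser (Q * z) + Q * (1 + z) * fser1 (Q * z) =
          (fser (Q * z) + Q * fser1 (Q * z)) + z * (Q * fser1 (Q * z)) by ring.
rewrite /fser /fser1 -(pser_scale q z e0) -(pser_scale q z e1) -(pserZ q z e1q).
rewrite -pserD//; apply: pser_eq_shift => //.
- exact: entire_coefD.
- rewrite /deriv_coef; have := fcoefS 0; rewrite !expr0 expr1 /=; lra.
move=> j; rewrite /deriv_coef; have := fcoefS j.+1.
rewrite -[j.+2%:R]natr1 -[j.+1%:R]natr1 !exprS.
move: (fcoef j.+2) (fcoef j.+1) (q ^+ j) => u v x h.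
apply/eqP; rewrite -subr_eq0; apply/eqP.
transitivity ((j%:R + 1 + 1) * ((1 - q * (q * x)) * u - q * x * v)); first by ring.
by rewrite h subrr mulr0.
Qed.

Lemma fser2E z :
  fser2 z = 2 * Q * fser1 (Q * z) + Q ^+ 2 * (1 + z) * fser2 (Q * z).
Proof.
have e1 := entire_fcoef1; have e2 := entire_fcoef2.
have e2q := entire_coef_scale q e2; have e1q := entire_coef_scale q e1.
have e2qq := entire_coefZ (q ^+ 2) e2q; have e1qq := entire_coefZ (2 * q) e1q.
have -> : 2 * Q * fser1 (Q * z) + Q ^+ 2 * (1 + z) * fser2 (Q * z) =
          (rc (2 * q) * fser1 (Q * z) + rc (q ^+ 2) * fser2 (Q * z)) +
          z * (rc (q ^+ 2) * fser2 (Q * z)).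
  have r2 : rc (2 : R) = 2 by rewrite /rc rmorph_nat.
  by rewrite rcM rcX r2; ring.
rewrite /fser1 /fser2 -(pser_scale q z e1) -(pser_scale q z e2).
rewrite -(pserZ _ z e2q) -(pserZ _ z e1q).
rewrite -pserD//; apply: pser_eq_shift => //.
- exact: entire_coefD.
- rewrite /deriv_coef; have := fcoefS 1; rewrite !expr0 expr1 /=; lra.
move=> j; rewrite /deriv_coef; have := fcoefS j.+2.
rewrite -[j.+3%:R]natr1 -[j.+2%:R]natr1 -[j.+1%:R]natr1 !exprS expr0.
move: (fcoef j.+3) (fcoef j.+2) (q ^+ j) => u v x h.
apply/eqP; rewrite -subr_eq0; apply/eqP.
transitivity ((j%:R + 1 + 1) * (j%:R + 1 + 1 + 1) *
  ((1 - q * (q * (q * x))) * u - q * (q * x) * v)); first by ring.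
by rewrite h subrr mulr0.
Qed.

Lemma PserE z : (1 + z) * Pser z = Pser (Q * z) + z * fser (Q * z).
Proof.
have e0 := entire_fcoef; have e1 := entire_pcoef.
have e0q := entire_coef_scale q e0; have e1q := entire_coef_scale q e1.
have e1n := entire_coefZ (-1) e1.
suff : Pser z = Pser (Q * z) + z * (fser (Q * z) + rc (-1) * Pser z).
  have -> : rc (-1 : R) = -1 by rewrite /rc rmorphN1.
  by move=> h; rewrite mulrDl mul1r {1}h; ring.
rewrite {2 3}/Pser /fser -(pser_scale q z e0) -(pser_scale q z e1) -(pserZ _ z e1).
rewrite -pserD//; apply: pser_eq_shift => //.
- exact: entire_coefD.
- by rewrite expr0 mul1r.
move=> j; have := fcoefS j; rewrite [pcoef j]pcoefE.
set a := fcoef j.+1; set b := fcoef j; set x := q ^+ j; set y := q ^+ j.+1 => h.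
rewrite mulN1r; apply/eqP; rewrite -subr_eq0; apply/eqP.
transitivity (pcoef j.+1 * ((1 - y) * a - x * b)); first by ring.
by rewrite h subrr mulr0.
Qed.

Lemma NserE z : (1 + z) * Nser z =
  Nser (Q * z) + Q * z ^+ 2 * fser1 (Q * z) + z * Pser z.
Proof.
have e0 := entire_fcoef; have e1 := entire_pcoef; have e2 := entire_ncoef.
have e2n := entire_coefZ (-1) e2; have e2q := entire_coef_scale q e2.
(* The coefficients j f_j belong to z f'(z). Taken at [Q * z] and multiplied by z, that series is
   the middle term on the right. *)
have e3 : entire_coef (fun j => j%:R * fcoef j).
  move=> r r0; have [K HK] := entire_fcoef1 r0.
  exists (r * K) => -[|n].
    by rewrite big_ord0 mulr_ge0//; have := HK 0%N; rewrite big_ord0.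
  rewrite big_ord_recl mul0r normr0 mul0r add0r.
  apply: le_trans (ler_wpM2l r0 (HK n)); rewrite mulr_sumr.
  by apply: ler_sum => j _; rewrite lift0 exprS mulrCA.
have e3q := entire_coef_scale q e3.
have E3 : pser (fun j => j%:R * fcoef j) (Q * z) = Q * z * fser1 (Q * z).
  by rewrite pserS// mul0r rc0 add0r.
have e12 := entire_coefD e1 e2n.
suff : Nser z = Nser (Q * z) + z * (Q * z * fser1 (Q * z) + (Pser z + rc (-1) * Nser z)).
  have -> : rc (-1 : R) = -1 by rewrite /rc rmorphN1.
  by move=> h; rewrite mulrDl mul1r {1}h; ring.
rewrite -E3 {2 3}/Nser /Pser -(pser_scale q z e3) -(pser_scale q z e2) -(pserZ _ z e2).
rewrite -2?pserD//; apply: pser_eq_shift => //.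
- exact: entire_coefD.
- by rewrite expr0 mul1r.
move=> j; have := fcoefS j; rewrite [ncoef j]ncoefE [pcoef j]pcoefE -natr1.
set a := fcoef j.+1; set b := fcoef j; set x := q ^+ j; set y := q ^+ j.+1 => h.
rewrite mulN1r; apply/eqP; rewrite -subr_eq0; apply/eqP.
transitivity (ncoef j.+1 * ((1 - y) * a - x * b)); first by ring.
by rewrite h subrr mulr0.
Qed.

Definition bezout z := Nser z * fser z - z * Pser z * fser1 z.

Lemma bezout_scale z : bezout z = bezout (Q * z).
Proof.
rewrite /bezout [in LHS]fserE [in LHS]fser1E.
have h1 := NserE z; have h2 := PserE z.
transitivity (((1 + z) * Nser z) * fser (Q * z) - z * Pser z * fser (Q * z)
   - Q * z * fser1 (Q * z) * ((1 + z) * Pser z)); first by ring.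
by rewrite h1 h2; ring.
Qed.

Lemma pser_near0 (a : nat -> R) : entire_coef a -> exists K : R, 0 <= K /\
  forall z, modulus z <= 1 -> modulus (pser a z) <= K /\
    modulus (pser a z - rc (a 0%N)) <= K * modulus z.
Proof.
move=> ea; have [K1 H1] := ea 1 ler01.
have eS := entire_coefS ea; have [K2 H2] := eS 1 ler01.
have K10 : 0 <= K1 by have := H1 0%N; rewrite big_ord0.
have K20 : 0 <= K2 by have := H2 0%N; rewrite big_ord0.
exists (K1 + K2); split; first by rewrite addr_ge0.
move=> z z1; have h1 := pser_bound ea z1 H1; have h2 := pser_bound eS z1 H2.
split; first by lra.
rewrite pserS// addrAC subrr add0r modulusM mulrC.
by rewrite ler_wpM2r ?modulus_ge0//; lra.
Qed.

Lemma modulus_qX n z : modulus (rc (q ^+ n) * z) = q ^+ n * modulus z.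
Proof. by rewrite modulusM modulus_rc gtr0_norm// qX_gt0. Qed.

(** Invariance replaces z by q^n z, which tends to 0, and there the expression tends to N(0) f(0),
    with f(0) = 1. The linear bounds of [pser_near0] stand in for continuity at 0. *)
Lemma bezoutE z : bezout z = rc (ncoef 0).
Proof.
have Wn n : bezout z = bezout (rc (q ^+ n) * z).
  elim: n => [|n IH]; first by rewrite expr0 rc1 mul1r.
  by rewrite IH bezout_scale mulrA -rcM exprS.
have [K1 [K10 HK1]] := pser_near0 entire_ncoef.
have [K2 [K20 HK2]] := pser_near0 entire_pcoef.
have [K3 [K30 HK3]] := pser_near0 entire_fcoef1.
have [K4 [K40 HK4]] := pser_near0 entire_fcoef.
have Hw w : modulus w <= 1 -> modulus (bezout w - rc (ncoef 0)) <=
    (K1 * K4 + 12 * K4 + K2 * K3) * modulus w.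
  move=> w1; have := HK1 w w1; have := HK2 w w1; have := HK3 w w1; have := HK4 w w1.
  rewrite -/(Nser w) -/(Pser w) -/(fser w) -/(fser1 w) /= !mulr1.
  move=> [h1 h2] [h3 _] [h5 _] [h7 h8].
  have -> : bezout w - rc (ncoef 0) = (Nser w - rc (ncoef 0)) * fser w +
    rc (ncoef 0) * (fser w - rc 1) - w * (Pser w * fser1 w).
    by rewrite /bezout rc1; ring.
  apply: le_trans (modulusB _ _) _.
  have := modulusD ((Nser w - rc (ncoef 0)) * fser w) (rc (ncoef 0) * (fser w - rc 1)).
  rewrite 4!modulusM modulus_rc.
  have := ler_pM (modulus_ge0 _) (modulus_ge0 _) h8 h1.
  have := ler_pM (normr_ge0 _) (modulus_ge0 _) (ncoef_bound 0) h2.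
  have := ler_wpM2l (modulus_ge0 w) (ler_pM (modulus_ge0 _) (modulus_ge0 _) h5 h3).
  lra.
set K := K1 * K4 + _ + _ in Hw.
have K0 : 0 <= K by rewrite !addr_ge0 ?mulr_ge0.
apply/eqP; rewrite -subr_eq0 -modulus_eq0 eq_le modulus_ge0 andbT.
apply/ler_addgt0Pr => e e0; rewrite add0r.
have z1 : 0 < modulus z + 1 by rewrite ltr_wpDl ?modulus_ge0.
have K1' : 0 < K + 1 by rewrite ltr_wpDl.
have [|J HJ] := qX_small (x := Num.min 1 (e / (K + 1)) / (modulus z + 1)).
  by rewrite divr_gt0// lt_min ltr01 divr_gt0.
have := HJ J (leqnn _); rewrite ltr_pdivlMr// lt_min => /andP[h1 h2].
have h3 : q ^+ J * modulus z <= q ^+ J * (modulus z + 1).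
  by rewrite ler_pM2l ?qX_gt0// lerDl.
rewrite (Wn J); apply: le_trans (Hw _ _) _; rewrite modulus_qX.
  by apply: le_trans h3 _; exact: ltW.
move: h2; rewrite ltr_pdivlMr// => h2.
have := ler_wpM2l K0 h3.
have : 0 <= q ^+ J * (modulus z + 1) by rewrite mulr_ge0// ltW// qX_gt0.
nra.
Qed.
End QExponential.

(** * Estimates away from the zeros of f *)

Section Estimates.
Variable R : realType.
Implicit Types z w : Cplx R.

Local Notation q := (q R).
Local Notation Q := (rc q).
Local Notation f := (@fser R).
Local Notation f1 := (@fser1 R).
Local Notation f2 := (@fser2 R).
Local Notation P := (@Pser R).

(** The powers of z in [ratio1] and [ratio2] cancel the powers of q that differentiating f(qz)
    produces, so that the recurrences under z -> qz contain no q. *)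
Definition ratio1 z := z * f1 z / f z.
Definition ratio2 z := z ^+ 2 * f2 z / f z.
Definition ratioP z := P z / f z.

Section Step.
Variable z : Cplx R.
Hypotheses (z1 : 1 + z != 0) (fz : f (Q * z) != 0).

Lemma ratio1E : ratio1 z = z / (1 + z) + ratio1 (Q * z).
Proof.
rewrite /ratio1 fser1E [f z]fserE.
move: fz; move: (f (Q * z)) (f1 (Q * z)) => a b a0; field.
by rewrite z1 a0.
Qed.

Lemma ratio2E : ratio2 z = 2 * (z / (1 + z)) * ratio1 (Q * z) + ratio2 (Q * z).
Proof.
rewrite /ratio1 /ratio2 fser2E [f z]fserE.
move: fz; move: (f (Q * z)) (f1 (Q * z)) (f2 (Q * z)) => a b c a0; field.
by rewrite z1 a0.
Qed.

Lemma ratioPE : ratioP z = (ratioP (Q * z) + z) / (1 + z) ^+ 2.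
Proof.
have h := PserE z.
have -> : ratioP z = ((1 + z) * P z) / ((1 + z) * f z).
  rewrite /ratioP -mulf_div divff// mul1r//.
rewrite h /ratioP [f z]fserE; move: fz; move: (f (Q * z)) (P (Q * z)) => a b a0; field.
by rewrite z1 a0.
Qed.
End Step.

Lemma modulus_Q z : modulus (Q * z) = modulus z / 16.
Proof. by rewrite modulusM modulus_rc gtr0_norm ?q_gt0// mulrC. Qed.

Lemma modulus2 : modulus (2 : Cplx R) = 2.
Proof.
have -> : (2 : Cplx R) = rc 2 by rewrite /rc rmorph_nat.
by rewrite modulus_rc normr_nat.
Qed.

Lemma modulus_neq0 z : 0 < modulus z -> z != 0.
Proof. by rewrite modulus_gt0. Qed.

Lemma modulus1D_ge z : modulus z - 1 <= modulus (1 + z).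
Proof. by have := modulusB_ge z (- 1); rewrite opprK modulusN modulus1 addrC [z + 1]addrC addrC. Qed.

(** Each step z -> qz costs a factor at least 15/16. After a number [s] of steps that does not
    depend on w the argument is so close to 0 that |f| >= 1/2. *)
Lemma fser_small_lower : exists c : R, 0 < c /\
  forall w, modulus w <= 16^-1 -> c <= modulus (f w).
Proof.
have [K [K0 HK]] := pser_near0 (@entire_fcoef R).
have K1 : 0 < K + 1 by rewrite ltr_wpDl.
have [|s Hs] := @qX_small R (2 * (K + 1))^-1; first by rewrite invr_gt0 mulr_gt0.
have Hn n : forall w, modulus w <= 16^-1 -> (15 / 16) ^+ n * modulus (f (rc (q ^+ n) * w))
     <= modulus (f w).
  elim: n => [|n IH] w wq; first by rewrite !expr0 rc1 !mul1r.
  have h : modulus (rc q * w) <= 16^-1.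
    rewrite modulus_Q; have := modulus_ge0 w; lra.
  have := IH _ h; rewrite mulrA -rcM -exprSr => {}IH.
  rewrite [in leRHS]fserE modulusM exprS -mulrA.
  apply: ler_pM => //; rewrite ?mulr_ge0 ?exprn_ge0 ?modulus_ge0//.
  have := modulusD_ge 1 w; rewrite modulus1; lra.
exists ((15 / 16) ^+ s * 2^-1); split; first by rewrite mulr_gt0 ?exprn_gt0.
move=> w wq; apply: le_trans (Hn s w wq).
rewrite ler_wpM2l ?exprn_ge0//.
have := Hs s (leqnn s); rewrite -div1r ltr_pdivlMr ?mulr_gt0// => h.
have qs := qX_gt0 R s.
have wle : modulus (rc (q ^+ s) * w) <= q ^+ s.
  by rewrite modulus_qX ler_piMr ?(ltW qs)//; lra.
have [|_] := HK (rc (q ^+ s) * w).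
  by apply: le_trans wle _; exact: qX_le1.
rewrite -/(f _) /= => h2.
have h3 := ler_wpM2l K0 wle.
have := modulusB_ge (1 : Cplx R) (1 - f (rc (q ^+ s) * w)).
rewrite subKr modulus1 modulusB_sym -/(rc (1 : R)) in h2 *.
nra.
Qed.

Lemma ratio_small_bound : exists C : R, 1 <= C /\
  forall w, modulus w <= 16^-1 ->
  [/\ modulus (ratio1 w) <= C, modulus (ratio2 w) <= C & modulus (ratioP w) <= C].
Proof.
have [c [c0 Hc]] := fser_small_lower.
have [K1 [K10 HK1]] := pser_near0 (@entire_fcoef1 R).
have [K2 [K20 HK2]] := pser_near0 (@entire_fcoef2 R).
have [K3 [K30 HK3]] := pser_near0 (@entire_pcoef R).
exists (1 + (K1 + K2 + K3) / c); split.
  by rewrite lerDl divr_ge0 ?addr_ge0// ltW.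
move=> w wq; have w1 : modulus w <= 1 by lra.
have fc := Hc w wq.
have [h1 _] := HK1 w w1; have [h2 _] := HK2 w w1; have [h3 _] := HK3 w w1.
have gen (y : Cplx R) : modulus y <= K1 + K2 + K3 ->
    modulus (y / f w) <= 1 + (K1 + K2 + K3) / c.
  move=> hy; rewrite modulusM modulusV.
  apply: le_trans (_ : (K1 + K2 + K3) / c <= _); last by rewrite lerDr.
  apply: ler_pM; rewrite ?invr_ge0 ?modulus_ge0//.
  by rewrite lef_pV2 ?posrE// (lt_le_trans c0).
split; apply: gen.
- rewrite modulusM; apply: le_trans (_ : 1 * K1 <= _); last by lra.
  by apply: ler_pM; rewrite ?modulus_ge0.
- rewrite modulusM modulusX; apply: le_trans (_ : 1 * K2 <= _); last by lra.
  by apply: ler_pM; rewrite ?exprn_ge0 ?exprn_ile1 ?modulus_ge0.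
- by apply: le_trans h3 _; lra.
Qed.

Lemma modulus_quot_le z (d : R) : 0 < d -> d <= 1 -> d <= modulus (1 + z) ->
  modulus (z / (1 + z)) <= 2 / d.
Proof.
move=> d0 d1 dz; have p : 0 < modulus (1 + z) by apply: lt_le_trans dz.
rewrite modulusM modulusV ler_pdivrMr// mulrAC ler_pdivlMr//.
have h := modulus1D_ge z.
have := ler_wpM2r (ltW d0) h.
have : modulus (1 + z) * d <= modulus (1 + z) * 1 by rewrite ler_pM2l.
lra.
Qed.

(** Two steps bring w to q^2 w, in the disk of radius 1/16 where everything is bounded; only the
    zeros -1 and -16 interfere. The power d^-4 is generous, but [ratio1] keeps the explicit 4/d,
    since its constant has to be compared with m later. *)
Lemma fser_near : exists (c C : R), [/\ 0 < c, 20 <= C &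
  forall w (d : R), 1 <= modulus w -> modulus w <= 16 -> 0 < d -> d <= 1 ->
    d <= modulus (1 + w) -> d <= modulus (1 + Q * w) ->
  [/\ c * d ^+ 2 <= modulus (f w), modulus (ratio1 w) <= C + 4 / d,
      modulus (ratio2 w) <= C / d ^+ 4 & modulus (ratioP w) <= C / d ^+ 4]].
Proof.
have [c [c0 Hc]] := fser_small_lower.
have [C [C1 HC]] := ratio_small_bound.
exists c, (20 * C); split => //; first by lra.
move=> w d w1 w16 d0 d1 dw dqw.
have u16 : modulus (Q * (Q * w)) <= 16^-1 by rewrite !modulus_Q; lra.
have fu := Hc _ u16; have [Lu L2u Ru] := HC _ u16.
have fu0 : f (Q * (Q * w)) != 0 by apply: modulus_neq0; apply: lt_le_trans fu.
have v0 : 1 + Q * w != 0 by apply: modulus_neq0; apply: lt_le_trans dqw.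
have w0 : 1 + w != 0 by apply: modulus_neq0; apply: lt_le_trans dw.
have fv : c * d <= modulus (f (Q * w)).
  by rewrite fserE modulusM mulrC; apply: ler_pM => //; exact: ltW.
have fv0 : f (Q * w) != 0.
  by apply: modulus_neq0; apply: lt_le_trans fv; rewrite mulr_gt0.
have e1 := modulus_quot_le d0 d1 dqw; have e2 := modulus_quot_le d0 d1 dw.
have i1 : 1 <= d^-1 by rewrite invf_ge1.
have i0 : 0 <= d^-1 by lra.
have d4E : (d ^+ 4)^-1 = d^-1 ^+ 4 by rewrite exprVn.
rewrite !d4E; set x := d^-1 in e1 e2 i1 i0 d4E *.
have v16 : modulus (Q * w) <= 1 by rewrite modulus_Q; lra.
have Lv : modulus (ratio1 (Q * w)) <= C + 2 * x.
  rewrite ratio1E//; apply: le_trans (modulusD _ _) _; lra.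
have L2v : modulus (ratio2 (Q * w)) <= C + 4 * x * C.
  rewrite ratio2E//; apply: le_trans (modulusD _ _) _.
  rewrite -mulrA [modulus (2 * _)]modulusM modulus2 modulusM.
  have := ler_pM (modulus_ge0 _) (modulus_ge0 _) e1 Lu; lra.
have inv2 y : d <= modulus (1 + y) -> modulus ((1 + y) ^+ 2)^-1 <= x ^+ 2.
  move=> h; rewrite modulusV modulusX -exprVn; apply: exprn_mono.
    by rewrite invr_ge0 modulus_ge0.
  by rewrite lef_pV2 ?posrE// (lt_le_trans d0).
have x2 : 1 <= x ^+ 2 by rewrite exprn_ege1.
have Rv : modulus (ratioP (Q * w)) <= (C + 1) * x ^+ 2.
  rewrite ratioPE// modulusM; apply: ler_pM; rewrite ?modulus_ge0 ?inv2//.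
  apply: le_trans (modulusD _ _) _; lra.
have xx : x <= x ^+ 2 by rewrite expr2 ler_peMl.
have x24 : x ^+ 2 <= x ^+ 4.
  by rewrite (_ : 4 = 2 + 2)%N// exprD ler_peMl// exprn_ge0.
split.
- rewrite fserE modulusM expr2 mulrCA; apply: ler_pM => //; first exact: ltW.
  by rewrite mulr_ge0// ltW.
- rewrite ratio1E//; apply: le_trans (modulusD _ _) _; lra.
- rewrite ratio2E//; apply: le_trans (modulusD _ _) _.
  rewrite -mulrA [modulus (2 * _)]modulusM modulus2 modulusM.
  have := ler_pM (modulus_ge0 _) (modulus_ge0 _) e2 Lv.
  move=> h.
  have hC := ler_wpM2l (_ : 0 <= C) xx.
  have hC2 := ler_wpM2l (_ : 0 <= C) x24.
  rewrite -/(2 * x) in h *.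
  have C0 : 0 <= C by lra.
  have := hC C0; have := hC2 C0.
  have : C * 1 <= C * x ^+ 2 by rewrite ler_wpM2l.
  have : x ^+ 2 <= C * x ^+ 2 by rewrite ler_peMl// exprn_ge0.
  rewrite expr2 in h *; lra.
- rewrite ratioPE// modulusM.
  apply: le_trans (_ : ((C + 1) * x ^+ 2 + 16) * x ^+ 2 <= _).
    apply: ler_pM; rewrite ?modulus_ge0 ?inv2//.
    apply: le_trans (modulusD _ _) _; lra.
  have x40 : 0 <= x ^+ 4 by rewrite exprn_ge0.
  have -> : ((C + 1) * x ^+ 2 + 16) * x ^+ 2 = (C + 1) * x ^+ 4 + 16 * x ^+ 2 by ring.
  have : x ^+ 4 <= C * x ^+ 4 by rewrite ler_peMl.
  lra.
Qed.

(** Going outwards from w, each of the m factors has modulus at least 15: |f| gains 15 each time,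
    [ratio1] gains z/(1+z), which is within 1/15 of 1, and the errors inherited by [ratioP] are
    damped. *)
Lemma fser_climb (w : Cplx R) (a l l2 r : R) : 1 <= modulus w -> 0 < a ->
  a <= modulus (f w) -> modulus (ratio1 w) <= l -> modulus (ratio2 w) <= l2 ->
  modulus (ratioP w) <= r ->
  forall m z, rc (q ^+ m) * z = w ->
  [/\ 15 ^+ m * a <= modulus (f z), modulus (ratio1 z - m%:R) <= l + m%:R / 15,
      modulus (ratio1 z) <= l + 2 * m%:R,
      modulus (ratio2 z) <= l2 + 4 * m%:R * (l + 2 * m%:R) &
      modulus (ratioP z) <= r + m%:R].
Proof.
move=> w1 a0 hf h1 h2 hP; elim => [|m IH] z.
  rewrite expr0 rc1 mul1r => ->.
  by rewrite expr0 mul1r !(mulr0, mul0r, addr0, subr0).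
rewrite exprSr rcM -mulrA => zw; have [hf' hd' h1' h2' hP'] := IH _ zw.
have qz : 1 <= modulus (Q * z).
  have := w1; rewrite -zw modulus_qX => /le_trans; apply.
  by rewrite ler_piMl ?modulus_ge0 ?qX_le1.
have z16 : 16 <= modulus z by have := qz; rewrite modulus_Q; lra.
have z15 : 15 <= modulus (1 + z).
  have := modulus1D_ge z; lra.
have z1 : 1 + z != 0 by apply: modulus_neq0; lra.
have fqz : f (Q * z) != 0.
  apply: modulus_neq0; apply: lt_le_trans hf'.
  by rewrite mulr_gt0// exprn_gt0.
have inv15 : (modulus (1 + z))^-1 <= 15^-1 by rewrite lef_pV2 ?posrE//; lra.
have invp : 0 <= (modulus (1 + z))^-1 by rewrite invr_ge0 modulus_ge0.
have quot1 : modulus (z / (1 + z) - 1) <= 15^-1.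
  have -> : z / (1 + z) - 1 = - (1 + z)^-1 by field.
  by rewrite modulusN modulusV.
have quot2 : modulus (z / (1 + z)) <= 2.
  have -> : z / (1 + z) = (z / (1 + z) - 1) + 1 by ring.
  apply: le_trans (modulusD _ _) _; rewrite modulus1; lra.
have l0 : 0 <= l by apply: le_trans h1; exact: modulus_ge0.
split.
- rewrite fserE modulusM exprS -mulrA; apply: ler_pM => //.
  by rewrite mulr_ge0 ?exprn_ge0// ltW.
- rewrite ratio1E// -natr1.
  have -> : z / (1 + z) + ratio1 (Q * z) - (m%:R + 1) =
    (z / (1 + z) - 1) + (ratio1 (Q * z) - m%:R) by ring.
  apply: le_trans (modulusD _ _) _; rewrite -natr1; lra.
- rewrite ratio1E//; apply: le_trans (modulusD _ _) _; rewrite -natr1; lra.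
- rewrite ratio2E//; apply: le_trans (modulusD _ _) _.
  rewrite -mulrA [modulus (2 * _)]modulusM modulus2 modulusM.
  have := ler_pM (modulus_ge0 _) (modulus_ge0 _) quot2 h1'.
  rewrite -natr1; have := ler0n R m; nra.
- rewrite ratioPE// modulusM modulusV modulusX.
  have zz : modulus z <= 2 * modulus (1 + z).
    have := modulus1D_ge z; lra.
  have hh : modulus (ratioP (Q * z) + z) <= r + m%:R + 2 * modulus (1 + z).
    by apply: le_trans (modulusD _ _) _; apply: lerD.
  rewrite ler_pdivrMr ?exprn_gt0//; last by lra.
  apply: le_trans hh _; rewrite -natr1.
  have r0 : 0 <= r by apply: le_trans hP; exact: modulus_ge0.
  have := ler0n R m; set y := modulus (1 + z) in z15 *.
  have y2 : 15 * y <= y ^+ 2 by rewrite expr2 ler_wpM2r//; lra.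
  move=> m0.
  have : (r + m%:R) * 1 <= (r + m%:R) * y ^+ 2.
    by rewrite ler_wpM2l ?addr_ge0//; lra.
  lra.
Qed.

(* The two lower bounds by 7 keep z away from the zeros -16^k with k = m, m+1,
   at relative distance 7/(k+1). *)
Lemma fser_far : exists (c C : R) (m0 : nat), [/\ 0 < c, 0 < C &
  forall m z, (m0 <= m)%N -> 16 ^+ m <= modulus z -> modulus z <= 16 ^+ m.+1 ->
    7 <= m.+1%:R * modulus (1 + rc (q ^+ m) * z) ->
    7 <= m.+2%:R * modulus (1 + rc (q ^+ m.+1) * z) ->
  [/\ c * 2 ^+ m <= modulus (f z), modulus (f z) <= modulus z * modulus (f1 z),
      modulus (f2 z) <= C * modulus (f z) &
      modulus (f2 z) * modulus (z * P z) <= C * modulus z * modulus (f z) ^+ 2]].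
Proof.
have [c [C [c0 C1 HC]]] := fser_near.
(* The summand 5 makes [7 / m.+2%:R] at most 1; the other one lets m outweigh the constant [C]. *)
pose m0 := (5 + Num.bound (10 * (C + 10)))%N.
exists c, (16 * (10 * C) + 256 * (10 * C) ^+ 2), m0.
have C0 : 0 <= C by lra.
have C2 : 0 <= (10 * C) ^+ 2 by rewrite exprn_ge0// mulr_ge0.
split => //; first by move: C1 C2; clear; lra.
move=> m z m0m mz zm hz1 hz2.
pose w := rc (q ^+ m) * z.
have qm : q ^+ m * 16 ^+ m = 1 by rewrite -exprMn mulVf// expr1n.
have w1 : 1 <= modulus w.
  by rewrite modulus_qX -qm ler_pM2l// qX_gt0.
have w16 : modulus w <= 16.
  rewrite modulus_qX; apply: le_trans (_ : q ^+ m * 16 ^+ m.+1 <= _).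
    by rewrite ler_pM2l// qX_gt0.
  by rewrite exprS mulrCA qm mulr1.
have mb : 10 * (C + 10) <= m%:R.
  apply: le_trans (ltW (archi_boundP _)) _; first by lra.
  by rewrite ler_nat; apply: leq_trans m0m; rewrite leq_addl.
have m5 : (5 <= m)%N by apply: leq_trans m0m; rewrite leq_addr.
have m2p : 0 < m.+2%:R :> R by [].
pose d : R := 7 / m.+2%:R.
have d0 : 0 < d by rewrite divr_gt0.
have d1 : d <= 1 by rewrite ler_pdivrMr// mul1r ler_nat !ltnS.
have dw : d <= modulus (1 + w).
  rewrite ler_pdivrMr// mulrC; apply: le_trans hz1 _.
  by rewrite ler_wpM2r ?modulus_ge0// ler_nat.
have dqw : d <= modulus (1 + Q * w).
  by rewrite ler_pdivrMr// mulrC /w mulrA -rcM -exprS.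
have [hf h1 h2 hP] := HC w d w1 w16 d0 d1 dw dqw.
have cd : 0 < c * d ^+ 2 by rewrite mulr_gt0// exprn_gt0.
have [gf gd g1 g2 gP] := fser_climb w1 cd hf h1 h2 hP (erefl : rc (q ^+ m) * z = w).
have zp : 0 < modulus z by apply: lt_le_trans mz; rewrite exprn_gt0.
have M2 : m.+2%:R <= 2 ^+ m.+1 :> R by rewrite -natrX ler_nat ltn_expl.
have dE : d^-1 = m.+2%:R / 7 by rewrite invf_div.
(* The loss d^2 is of size m^-2 only. Since (m+2)^2 <= 4^(m+1), it is covered by comparing 2^m
   4^(m+1) = 4 * 8^m with 49 * 15^m. *)
have F1 : c * 2 ^+ m <= modulus (f z).
  apply: le_trans gf; rewrite mulrCA ler_pM2l//.
  rewrite /d expr_div_n mulrA ler_pdivlMr ?exprn_gt0//.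
  have h3 : m.+2%:R ^+ 2 <= (2 ^+ m.+1) ^+ 2 :> R by apply: exprn_mono.
  have h4 : 2 ^+ m * (2 ^+ m.+1) ^+ 2 = 8 ^+ m * 4 :> R.
    have -> : 8 ^+ m = 2 ^+ m * 2 ^+ m * 2 ^+ m :> R.
      by rewrite -!exprMn; congr (_ ^+ _); ring.
    by rewrite [2 ^+ m.+1]exprS; move: (2 ^+ m) => x; ring.
  apply: le_trans (_ : 2 ^+ m * (2 ^+ m.+1) ^+ 2 <= _).
    by rewrite ler_wpM2l ?exprn_ge0.
  rewrite h4; apply: ler_pM; rewrite ?exprn_ge0//.
    by apply: exprn_mono; rewrite ?ler_nat.
  by rewrite -natrX ler_nat.
have fp : 0 < modulus (f z) by apply: lt_le_trans F1; rewrite mulr_gt0// exprn_gt0.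
(* The distance from [ratio1 z] to m is at most C + 4/d + m/15, and 4/d = 4(m+2)/7. As 4/7 + 1/15 <
   1, more than 1 is left for large m. *)
have Lge : 1 <= modulus (ratio1 z).
  have mm : modulus (m%:R : Cplx R) = m%:R.
    have -> : (m%:R : Cplx R) = rc m%:R by rewrite /rc rmorph_nat.
    by rewrite modulus_rc normr_nat.
  have := modulusB_ge (m%:R : Cplx R) (m%:R - ratio1 z).
  rewrite subKr mm modulusB_sym => h.
  have m2E : m.+2%:R = m%:R + 2 :> R by rewrite -addn2 natrD.
  have h4 : 4 / d = 4 * (m%:R + 2) / 7 by rewrite dE m2E mulrA.
  by rewrite h4 in gd; move: gd h mb C1; clear; lra.
have d4 : (d ^+ 4)^-1 <= m.+2%:R ^+ 4.
  rewrite -exprVn; apply: exprn_mono; first by rewrite invr_ge0 ltW.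
  by rewrite dE; move: m2p; clear; lra.
have M4 : m.+2%:R ^+ 2 <= m.+2%:R ^+ 4 :> R.
  by rewrite ler_weXn2l// ler1n.
have M1 : 1 <= m.+2%:R :> R by rewrite ler1n.
have M12 : m.+2%:R <= m.+2%:R ^+ 2 :> R by rewrite expr2 ler_peMl.
have mM : m%:R <= m.+2%:R :> R by rewrite ler_nat leqW.
have CM4 := ler_wpM2l C0 M4; have CM2 := ler_wpM2l C0 M12.
have Cd4 := ler_wpM2l C0 d4.
set M : R := m.+2%:R in M1 M4 M12 mM M2 CM4 CM2 Cd4 d4 dE *.
have M40 : 0 <= M ^+ 4 by rewrite exprn_ge0//; lra.
have G2 : modulus (ratio2 z) <= 10 * C * M ^+ 4.
  apply: le_trans g2 _.
  have e4 : 4 / d = 4 * M / 7 by rewrite dE mulrA.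
  rewrite e4.
  have m0' : 0 <= m%:R :> R by [].
  have : 4 * m%:R * (C + 4 * M / 7 + 2 * m%:R) <= 4 * M * (C + 4 * M / 7 + 2 * M).
    by apply: ler_pM; move: m0' mM M1 C1; clear; lra.
  have -> : 4 * M * (C + 4 * M / 7 + 2 * M) = 4 * (C * M) + (16 / 7 + 8) * M ^+ 2.
    by rewrite expr2; field.
  have : 20 * M ^+ 4 <= C * M ^+ 4 by rewrite ler_wpM2r.
  by move: Cd4 CM2 CM4 M4 M40 M12; clear; lra.
have GP : modulus (ratioP z) <= 10 * C * M ^+ 4.
  apply: le_trans gP _.
  have : 1 * M ^+ 4 <= C * M ^+ 4 by rewrite ler_wpM2r//; move: C1; clear; lra.
  by move: Cd4 mM M12 M4 M40; clear; lra.
have K0 : 0 <= 10 * C by rewrite mulr_ge0.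
(* From m + 2 <= 2^(m+1) and 2^4 = 16, the fourth power of m + 2 is at most 16^(m+1). Polynomial
   losses in m are thus paid with one power of |z|. *)
have Mz : M ^+ 4 <= 16 * modulus z.
  apply: le_trans (exprn_mono 4 _ M2) _; first by move: M1; clear; lra.
  rewrite -exprM mulnC exprM (_ : 2 ^+ 4 = 16); last by rewrite -natrX.
  by rewrite exprS ler_pM2l.
have f0 : f z != 0 by rewrite -modulus_gt0.
have z0 : z != 0 by rewrite -modulus_gt0.
have z1 : 1 <= modulus z by apply: le_trans mz; rewrite exprn_ege1// ler1n.
have zz : modulus z <= modulus z ^+ 2 by rewrite expr2 ler_peMl// modulus_ge0.
have E2 : modulus z ^+ 2 * modulus (f2 z) = modulus (ratio2 z) * modulus (f z).
  by rewrite -modulusX -!modulusM /ratio2 mulfVK.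
have EP : modulus (P z) = modulus (ratioP z) * modulus (f z).
  by rewrite -modulusM /ratioP mulfVK.
have p2 : 0 < modulus z ^+ 2 by rewrite exprn_gt0.
split => //.
- rewrite -modulusM -[leLHS]mul1r.
  have -> : z * f1 z = ratio1 z * f z by rewrite /ratio1 mulfVK.
  by rewrite modulusM ler_pM2r.
- rewrite -(ler_pM2l p2) E2 mulrCA mulrA ler_pM2r//.
  apply: le_trans G2 _.
  apply: le_trans (ler_wpM2l K0 Mz) _.
  have h1' : 16 * (10 * C) * modulus z <= 16 * (10 * C) * modulus z ^+ 2.
    by rewrite ler_wpM2l//; move: C0; clear; lra.
  by move: (mulr_ge0 C2 (ltW p2)) h1'; clear; lra.
- rewrite modulusM EP -(ler_pM2l p2).
  have -> : modulus z ^+ 2 * (modulus (f2 z) * (modulus z * (modulus (ratioP z) * modulus (f z))))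
    = (modulus z * modulus (f z) ^+ 2) * (modulus (ratio2 z) * modulus (ratioP z)).
    by rewrite [LHS]mulrA E2; ring.
  set C' := 16 * (10 * C) + _.
  have -> : modulus z ^+ 2 * (C' * modulus z * modulus (f z) ^+ 2) =
    (modulus z * modulus (f z) ^+ 2) * (C' * modulus z ^+ 2) by ring.
  rewrite ler_wpM2l ?mulr_ge0 ?exprn_ge0 ?modulus_ge0//.
  have h5 := ler_pM (modulus_ge0 _) (modulus_ge0 _) G2 GP.
  have h3 : M ^+ 4 * M ^+ 4 <= (16 * modulus z) * (16 * modulus z) by apply: ler_pM.
  have h4 := ler_wpM2l C2 h3.
  apply: le_trans h5 _.
  have -> : 10 * C * M ^+ 4 * (10 * C * M ^+ 4) = (10 * C) ^+ 2 * (M ^+ 4 * M ^+ 4) by ring.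
  apply: le_trans h4 _.
  have -> : C' * modulus z ^+ 2 = 16 * (10 * C) * modulus z ^+ 2 +
     (10 * C) ^+ 2 * (16 * modulus z * (16 * modulus z)) by rewrite /C'; ring.
  by rewrite lerDr !mulr_ge0 ?exprn_ge0 ?modulus_ge0//; lra.
Qed.
End Estimates.

(** * Upper bounds for the growth of f *)

Section Growth.
Variable R : realType.

Local Notation q := (q R).
Local Notation fr := (pser_real (fcoef R)).

Lemma near_pinfty (P : R -> Prop) (r0 : R) :
  (forall r, r0 < r -> P r) -> \forall r \near +oo, P r.
Proof. by move=> H; exists r0; split; [exact: num_real|exact: H]. Qed.

Lemma near_pinftyP (P : R -> Prop) :
  (\forall r \near +oo, P r) -> exists r0 : R, forall r, r0 < r -> P r.
Proof. by move=> [r0 [_ H]]; exists r0. Qed.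

Lemma fr_step (x : R) : fr x = (1 + x) * fr (q * x).
Proof.
have e := @entire_fcoef R.
have := fserE (rc x); rewrite /fser -rcM !pser_realE// -rc1 -rcD -rcM.
by case.
Qed.

Lemma fr_mono (x y : R) : 0 <= x -> x <= y -> fr x <= fr y.
Proof. exact: (pser_real_mono (@fcoef_ge0 R) (@entire_fcoef R)). Qed.

Lemma fr_ge1 (x : R) : 0 <= x -> 1 + x <= fr x.
Proof.
move=> x0; apply: le_trans (psum_le_pser_real (@fcoef_ge0 R) (@entire_fcoef R) 2 x0).
rewrite big_ord_recl big_ord1 lift0 expr0 expr1 mulr1 lerD2l ler_peMl//.
have := fcoefS R 0; rewrite expr0 expr1 mul1r => h.
have := mulr_ge0 (ltW (q_gt0 R)) (@fcoef_ge0 R 1).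
change (fcoef R 0) with (1 : R) in h; lra.
Qed.

(** Passing from radius 16^m to 16^(m+1) multiplies by 1 + x <= 16^(m+2). The exponents add up to a
    quadratic in m, that is, to (log x)^2. *)
Lemma fr_growth : exists C : R, 1 <= C /\
  forall m x, 0 <= x -> x <= 16 ^+ m -> fr x <= C * 16 ^+ (m.+1 * m).
Proof.
exists (fr 1); split; first by have := @fr_ge1 1 ler01; lra.
elim=> [|m IH] x x0 xm.
  by rewrite muln0 expr0 mulr1 fr_mono.
rewrite fr_step.
have qx : q * x <= 16 ^+ m.
  by rewrite mulrC ler_pdivrMr// mulrC -exprS.
have qx0 : 0 <= q * x by rewrite mulr_ge0// ltW// q_gt0.
have := IH _ qx0 qx => h.
have p1 : 1 <= 16 ^+ m.+1 :> R by rewrite exprn_ege1// ler1n.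
have h2 : 1 + x <= 16 ^+ m.+2 by rewrite exprS; lra.
apply: le_trans (ler_pM _ _ h2 h) _; first by lra.
  by apply: le_trans (fr_ge1 qx0); lra.
rewrite mulrCA -exprD ler_wpM2l//.
  by apply: le_trans (@fr_ge1 1 ler01); lra.
rewrite ler_weXn2l ?ler1n//.
by rewrite [leqRHS]mulSn mulnS addnA leq_add2r addSnnS leq_addl.
Qed.

Lemma scale16 (r : R) : 1 <= r -> exists m : nat, 16 ^+ m <= r /\ r < 16 ^+ m.+1.
Proof.
move=> r1; have r0 : 0 <= r by lra.
have t0 : (0 < Num.trunc r)%N by rewrite truncn_gt0.
have /andP[h1 h2] := trunc_log_bounds (isT : (1 < 16)%N) t0.
exists (trunc_log 16 (Num.trunc r)); split.
  apply: le_trans (_ : (Num.trunc r)%:R <= _); last by rewrite truncn_le.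
  by rewrite -natrX ler_nat.
apply: lt_le_trans (truncnS_gt r) _.
by rewrite -natrX ler_nat.
Qed.

(** From e^(-1/2) >= 1 - 1/2 one gets e <= 4. *)
Lemma ln16_ge1 : 1 <= ln 16 :> R.
Proof.
rewrite -[leLHS]expRK ler_ln ?posrE ?expR_gt0//.
have : expR 1 = (expR (2^-1)) ^+ 2 :> R.
  by rewrite expr2 -expRD; congr expR; lra.
have h : expR (2^-1) <= 2 :> R.
  have := expR_ge1Dx (- 2^-1 : R); rewrite expRN => h.
  have p := expR_gt0 (2^-1 : R).
  have := ler_wpM2r (ltW p) h; rewrite mulVf ?gt_eqF//; lra.
move=> ->; apply: le_trans (exprn_mono 2 _ h) _; first exact: expR_ge0.
by rewrite expr2; lra.
Qed.

(** The argument [4 * r] is the one produced by two uses of [pser_real_deriv_le], for f''. The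
    summand 2 keeps the right side positive at r = 1. *)
Lemma ln_fr_le : exists K : R, 0 < K /\
  forall r, 1 <= r -> ln (fr (4 * r)) <= K * (2 + ln r) ^+ 2.
Proof.
have [C [C1 HC]] := fr_growth.
have l1 := ln16_ge1.
have lC : 0 <= ln C by rewrite ln_ge0.
exists (ln C + 2 * ln 16); split; first by lra.
move=> r r1; have [m [h1 h2]] := scale16 r1.
have rp : 0 < r by lra.
have r4 : 0 <= 4 * r by lra.
have h3 : 4 * r <= 16 ^+ m.+2.
  by rewrite exprS; lra.
have p16 : 0 < 16 ^+ m :> R by rewrite exprn_gt0.
have := HC _ _ r4 h3; set e := (m.+3 * m.+2)%N => h4.
have f0 : 0 < fr (4 * r) by apply: lt_le_trans (fr_ge1 r4); lra.
have E0 : 0 < 16 ^+ e :> R by rewrite exprn_gt0.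
have C0 : 0 < C by lra.
have : ln (fr (4 * r)) <= ln (C * 16 ^+ e).
  by rewrite ler_ln ?posrE// mulr_gt0.
move=> /le_trans; apply; rewrite lnM ?posrE// lnXn// -[ln 16 *+ e]mulr_natr.
have mr : m%:R * ln 16 <= ln r.
  have : ln (16 ^+ m) <= ln r by rewrite ler_ln ?posrE.
  by rewrite lnXn// -[ln 16 *+ m]mulr_natl.
have m0 := ler0n R m.
set y := ln r in mr *; set l := ln 16 in mr l1 *.
have my : m%:R <= y by apply: le_trans mr; rewrite ler_peMr.
have eE : e%:R = (m%:R + 3) * (m%:R + 2) :> R.
  by rewrite /e natrM -[m.+3]addn3 -[m.+2]addn2 !natrD.
rewrite eE.
have s1 : (m%:R + 3) * (m%:R + 2) <= (y + 3) * (y + 2) by apply: ler_pM; lra.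
have s2 : (y + 3) * (y + 2) <= 2 * (2 + y) ^+ 2 by rewrite expr2; nra.
have s3 : 1 <= (2 + y) ^+ 2 by rewrite exprn_ege1//; lra.
have s4 := ler_wpM2l (_ : 0 <= l) (le_trans s1 s2).
have := s4 (ltac:(lra)).
have : ln C * 1 <= ln C * (2 + y) ^+ 2 by rewrite ler_wpM2l.
lra.
Qed.

(* e^(s y) >= (s y)^3 / 6 beats any multiple of (2 + y)^2, with y = ln r. *)
Lemma polylog_le_powR (K s e : R) : 0 < s -> 0 < e ->
  \forall r \near +oo, K * (2 + ln r) ^+ 2 <= e * r `^ s.
Proof.
move=> s0 e0.
pose y0 : R := 2 + 24 * `|K| / (e * s ^+ 3).
have s3 : 0 < s ^+ 3 by rewrite exprn_gt0.
have es : 0 < e * s ^+ 3 by rewrite mulr_gt0.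
have y02 : 2 <= y0 by rewrite lerDl divr_ge0 ?mulr_ge0// ltW.
apply: (@near_pinfty _ (expR y0)) => r hr.
have r0 : 0 < r by apply: lt_trans hr; exact: expR_gt0.
rewrite /powR gt_eqF//.
have hy : y0 < ln r by rewrite -[y0]expRK ltr_ln ?posrE// expR_gt0.
set y := ln r in hy *.
have yp : 2 < y by lra.
have sy0 : 0 <= s * y by rewrite mulr_ge0//; lra.
have h1 := @expR_ge1Dxn R (s * y) 2 sy0.
have h2 : (s * y) ^+ 3 / 6 <= expR (s * y) by rewrite (_ : 6 = 3`!%:R)//; lra.
apply: le_trans (_ : `|K| * (4 * y ^+ 2) <= _).
  apply: le_trans (_ : `|K| * (2 + y) ^+ 2 <= _).
    by rewrite ler_wpM2r ?exprn_ge0 ?ler_norm//; lra.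
  by rewrite ler_wpM2l// !expr2; nra.
apply: le_trans (_ : e * ((s * y) ^+ 3 / 6) <= _); last by rewrite ler_pM2l.
have : 24 * `|K| / (e * s ^+ 3) <= y by rewrite /y0 in hy; lra.
rewrite ler_pdivrMr// => h3.
have y2 : 0 <= y ^+ 2 by rewrite exprn_ge0//; lra.
have := ler_wpM2r y2 h3.
have -> : y * (e * s ^+ 3) * y ^+ 2 = e * (s * y) ^+ 3 by ring.
lra.
Qed.
End Growth.

(** * The complex exponential *)

Section ComplexExponential.
Variable R : realType.
Implicit Types (z w : Cplx R) (x y : R).

Lemma MVT0 (g dg : R -> R) : (forall x : R, is_derive x 1 g (dg x)) ->
  forall y, exists2 c, `|c| <= `|y| & g y - g 0 = dg c * y.
Proof.
move=> Hg y.
have cg : continuous g.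
  by move=> x; apply: differentiable_continuous; apply/derivable1_diffP; case: (Hg x).
have [y0|y0] := leP 0 y.
  have [c] := @MVT_segment _ g dg 0 y y0 (fun x _ => Hg x) (continuous_subspaceT cg).
  rewrite in_itv /= subr0 => /andP[c0 cy] ->; exists c => //.
  by rewrite !ger0_norm// (le_trans c0).
have [c] := @MVT_segment _ g dg y 0 (ltW y0) (fun x _ => Hg x) (continuous_subspaceT cg).
rewrite in_itv /= sub0r => /andP[cy c0] h; exists c; last by lra.
by rewrite !ler0_norm ?(ltW y0)// lerN2.
Qed.

Lemma sin_norm_le y : `|sin y| <= `|y|.
Proof.
have [c _] := MVT0 (@is_derive_sin R) y.
rewrite sin0 subr0 => ->; rewrite normrM ler_piMl// cos_max//.
Qed.

Lemma cosB1_norm_le y : `|cos y - 1| <= y ^+ 2.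
Proof.
have [c cy] := MVT0 (@is_derive_cos R) y.
rewrite cos0 => ->; rewrite normrM normrN -real_normK ?num_real// expr2.
by rewrite ler_wpM2r// (le_trans (sin_norm_le _)).
Qed.

Lemma cosB1_norm_le2 y : `|cos y - 1| <= `|y|.
Proof.
have [c cy] := MVT0 (@is_derive_cos R) y.
by rewrite cos0 => ->; rewrite normrM normrN ler_piMl// sin_max.
Qed.

Lemma sinB_norm_le y : `|sin y - y| <= y ^+ 2.
Proof.
have H x : is_derive x 1 (fun x => sin x - x) (cos x - 1).
  by apply: is_deriveB.
have [c cy] := MVT0 H y.
rewrite sin0 !subr0 => ->; rewrite normrM -real_normK ?num_real// expr2.
by rewrite ler_wpM2r// (le_trans (cosB1_norm_le2 _)).
Qed.

Lemma expRB1_norm_le x : `|x| <= 2^-1 -> `|expR x - 1 - x| <= 2 * x ^+ 2.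
Proof.
rewrite ler_norml => /andP[h1 h2].
have e1 := expR_ge1Dx x.
rewrite ger0_norm; last by lra.
have := expR_ge1Dx (- x); rewrite expRN => h.
have p := expR_gt0 x.
have := ler_wpM2r (ltW p) h; rewrite mulVf ?gt_eqF// => {}h.
have : (1 - x) * (expR x - 1 - x) <= x ^+ 2 by rewrite expr2; nra.
set t := expR x - 1 - x in e1 *; move=> h3.
have t0 : 0 <= t by rewrite /t; lra.
have : 2^-1 * t <= (1 - x) * t by rewrite ler_wpM2r//; lra.
lra.
Qed.

Definition cexp z : Cplx R := polar (expR (complex.Re z)) (complex.Im z).

Lemma cexpD z w : cexp (z + w) = cexp z * cexp w.
Proof.
case: z => a b; case: w => c d; rewrite /cexp /polar /= expRD cosD sinD.
by apply/eqP; rewrite eq_complex /=; apply/andP; split; apply/eqP; ring.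
Qed.

Lemma modulus_cexp z : modulus (cexp z) = expR (complex.Re z).
Proof. by rewrite modulus_polar// expR_ge0. Qed.

Lemma cexp_error z : modulus z <= 2^-1 ->
  modulus (cexp z - 1 - z) <= 10 * modulus z ^+ 2.
Proof.
move=> z1; have hx := ler_Re_modulus z; have hy := ler_Im_modulus z.
apply: le_trans (modulus_le_ReIm _) _.
move: hx hy; rewrite /cexp /polar; case: z z1 => x y; set m := modulus _ => m1 /= hx hy.
rewrite subr0.
have x1 : `|x| <= 2^-1 by apply: le_trans hx m1.
have e1 := expRB1_norm_le x1.
have xx : `|x| ^+ 2 = x ^+ 2 by rewrite real_normK ?num_real.
have yy : `|y| ^+ 2 = y ^+ 2 by rewrite real_normK ?num_real.
have xm : x ^+ 2 <= m ^+ 2 by rewrite -xx exprn_mono.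
have ym : y ^+ 2 <= m ^+ 2 by rewrite -yy exprn_mono.
have xym : `|x| * `|y| <= m ^+ 2 by rewrite expr2 ler_pM.
have eb : expR x <= 2.
  move: e1 x1; rewrite !ler_norml => /andP[_ h] /andP[h1 h2].
  have : x ^+ 2 <= 2^-1 * 2^-1 by rewrite expr2; nra.
  lra.
have eb2 : `|expR x - 1| <= 2 * `|x|.
  have -> : expR x - 1 = (expR x - 1 - x) + x by ring.
  apply: le_trans (ler_normD _ _) _.
  have : x ^+ 2 <= 2^-1 * `|x| by rewrite -xx expr2 ler_wpM2r.
  lra.
have H1 : `|expR x * cos y - 1 - x| <= 2 * m ^+ 2 + 2 * m ^+ 2.
  have -> : expR x * cos y - 1 - x = (expR x - 1 - x) + expR x * (cos y - 1) by ring.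
  apply: le_trans (ler_normD _ _) _; apply: lerD; first by lra.
  rewrite normrM (gtr0_norm (expR_gt0 x)).
  by apply: ler_pM; rewrite ?expR_ge0//; exact: le_trans (cosB1_norm_le y) ym.
have H2 : `|expR x * sin y - y| <= 2 * m ^+ 2 + m ^+ 2.
  have -> : expR x * sin y - y = (expR x - 1) * sin y + (sin y - y) by ring.
  apply: le_trans (ler_normD _ _) _; apply: lerD; last first.
    exact: le_trans (sinB_norm_le y) ym.
  rewrite normrM; apply: le_trans (ler_pM _ _ eb2 (sin_norm_le y)) _ => //.
  lra.
have : 0 <= m ^+ 2 by apply: le_trans xm; rewrite sqr_ge0.
lra.
Qed.

Lemma is_derive_cexp z : is_derive z 1 cexp (cexp z).
Proof.
apply: (@is_derive_quadratic _ _ _ _ (modulus (cexp z) * 10)) => h h1.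
have -> : cexp (z + h) - cexp z - h * cexp z = cexp z * (cexp h - 1 - h).
  by rewrite cexpD; ring.
by rewrite modulusM -mulrA ler_wpM2l ?modulus_ge0// cexp_error.
Qed.

Definition ipi k : Cplx R := 0 +i* (pi * (k.*2.+1)%:R).

Lemma cexp_ipi k : cexp (ipi k) = -1.
Proof.
rewrite /cexp /polar /= expR0 !mul1r.
have -> : pi * (k.*2.+1)%:R = pi + (pi *+ 2) *+ k :> R.
  by rewrite -addn1 natrD -mul2n natrM -mulrnA -[_ *+ (2 * k)]mulr_natr natrM; ring.
rewrite (periodicn (@cosD2pi R)) (periodicn (@sinD2pi R)) cospi sinpi.
by apply/eqP; rewrite eq_complex /= oppr0 !eqxx.
Qed.

Lemma modulus_sqr z : modulus z ^+ 2 = complex.Re z ^+ 2 + complex.Im z ^+ 2.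
Proof. by rewrite /modulus; case: z => a b /=; rewrite sqr_sqrtr// addr_ge0 ?sqr_ge0. Qed.

(** Both summands are nonnegative: the first detects a real part away from 0, the second an
    imaginary part away from the multiples of 2 pi. *)
Lemma cexpB1_sqr z : modulus (cexp z - 1) ^+ 2 =
  (expR (complex.Re z) - 1) ^+ 2 + 2 * expR (complex.Re z) * (1 - cos (complex.Im z)).
Proof.
rewrite modulus_sqr; case: z => x y /=; rewrite subr0.
have := cos2Dsin2 y => h.
have -> : (expR x * cos y - 1) ^+ 2 + (expR x * sin y) ^+ 2 =
  expR x ^+ 2 * (cos y ^+ 2 + sin y ^+ 2) - 2 * expR x * cos y + 1 by ring.
by rewrite h; ring.
Qed.

Lemma ler_sqr_modulus z (x : R) : 0 <= x -> x ^+ 2 <= modulus z ^+ 2 -> x <= modulus z.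
Proof. by move=> x0; rewrite ler_pXn2r ?nnegrE ?modulus_ge0. Qed.

(** For |w| <= 1/20 the error 10 |w|^2 of [cexp_error] is at most half of |w|. Otherwise the real or
    the imaginary part is at least 1/40 in absolute value, and one summand of [cexpB1_sqr] is
    bounded below; for the second, the cosine decreases on [0, pi]. *)
Lemma cexpB1_lower : exists k : R, 0 < k /\ forall (d : R) w, 0 <= d -> d <= 1 ->
  d <= modulus w -> `|complex.Im w| <= pi -> k * d <= modulus (cexp w - 1).
Proof.
have pi2 := @pi_ge2 R.
have i0 : (0 : R) \in `[0, pi]%R by rewrite in_itv /= lexx; lra.
have i1 : (40^-1 : R) \in `[0, pi]%R by rewrite in_itv /= invr_ge0 ler0n; lra.
have c1 : cos (40^-1) < 1 :> R by rewrite -[ltRHS]cos0 ltr_cos// invr_gt0.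
pose k0 : R := 1 - cos (40^-1).
have k00 : 0 < k0 by rewrite /k0; lra.
have k01 : k0 <= 1.
  have := @cosB1_norm_le2 40^-1; rewrite distrC ger0_norm /k0; last by lra.
  by rewrite ger0_norm ?invr_ge0//; lra.
pose k := Num.min 2^-1 (Num.min 41^-1 k0).
have k1 : k <= 2^-1 by rewrite /k ge_min lexx.
have k2 : k <= 41^-1 by rewrite /k !ge_min lexx orbT.
have k3 : k <= k0 by rewrite /k !ge_min lexx !orbT.
have kp : 0 < k by rewrite /k !lt_min !invr_gt0 !ltr0n.
exists k; split => // d w d0 d1 dw wpi.
have kd : k * d <= k by rewrite ler_piMr// ltW.
have [ws|wb] := leP (modulus w) 20^-1.
  have := modulusB_ge (w : Cplx R) (w - (cexp w - 1)); rewrite subKr modulusB_sym.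
  have w2 : modulus w <= 2^-1 by lra.
  have h1 := cexp_error w2; move=> h2.
  have h3 : modulus w ^+ 2 <= 20^-1 * modulus w by rewrite expr2 ler_wpM2r ?modulus_ge0.
  have h4 : k * d <= 2^-1 * modulus w.
    by apply: ler_pM => //; exact: ltW.
  lra.
apply: le_trans kd _; apply: ler_sqr_modulus; first exact: ltW.
rewrite cexpB1_sqr; have := modulus_le_ReIm w.
set x := complex.Re w; set y := complex.Im w in wpi * => hxy.
have ex := expR_gt0 x.
have c0 : 0 <= 2 * expR x * (1 - cos y).
  by rewrite mulr_ge0 ?mulr_ge0 ?(ltW ex)//; have := cos_le1 y; lra.
have [xs|xb] := leP `|x| 40^-1; last first.
  have : 41^-1 <= `|expR x - 1|.
    move: xb; have [x0|x0] := leP 0 x => xb.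
      rewrite (ger0_norm x0) in xb.
      by have e := expR_ge1Dx x; rewrite ger0_norm; lra.
    rewrite (ltr0_norm x0) in xb.
    rewrite ler0_norm; last first.
      by have := expR_lt1 x; rewrite x0 => h; rewrite subr_le0 ltW.
    have := expR_ge1Dx (- x); rewrite expRN => h.
    have := ler_wpM2r (ltW ex) h; rewrite mulVf ?gt_eqF// => {}h.
    have : (1 + 40^-1) * expR x <= (1 - x) * expR x by rewrite ler_pM2r//; lra.
    lra.
  move=> h; rewrite -[leLHS]addr0 lerD// -[leRHS]real_normK ?num_real//.
  by apply: exprn_mono; [exact: ltW|exact: le_trans k2 h].
have yb : 40^-1 <= `|y| by lra.
have cy : cos y <= cos (40^-1).
  by rewrite -(cos_norm y) leNgt ltr_cos -?leNgt// in_itv /= normr_ge0.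
have e2 : 2^-1 <= expR x.
  have := expR_ge1Dx x; move: xs; rewrite ler_norml => /andP[]; lra.
rewrite -[leLHS]add0r lerD ?sqr_ge0//.
apply: le_trans (_ : 1 * k0 <= _); last first.
  by apply: ler_pM; move: e2 k00 cy; rewrite /k0; clear; lra.
rewrite mul1r expr2; apply: le_trans (_ : 1 * k <= _); last by rewrite mul1r.
by rewrite ler_pM2r//; lra.
Qed.

(** For Re z >= 1 the exponential dominates 1. For Re z < 1 a translation by the nearest zero
    reduces to [cexpB1_lower]. The factor |z|^2 pays for the small disks: the index n of that zero
    satisfies n <= |z|, so (n+1)(n+2) <= 6 |z|^2. *)
Lemma cexp_plus1_lower : exists c : R, 0 < c /\ forall z, 1 <= modulus z ->
  (forall k, (k.+1%:R * k.+2%:R)^-1 <= modulus (z - ipi k)) ->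
  (forall k, (k.+1%:R * k.+2%:R)^-1 <= modulus (z + ipi k)) ->
  c * expR (Num.max 0 (complex.Re z)) <= modulus z ^+ 2 * modulus (cexp z + 1).
Proof.
have [k [k0 Hk]] := cexpB1_lower.
have e1 := expR_gt0 (1 : R).
exists (Num.min 2^-1 (k / (6 * expR 1))); split.
  by rewrite lt_min invr_gt0 ltr0n divr_gt0// mulr_gt0.
set c := Num.min _ _ => z z1 offp offm.
have c1 : c <= 2^-1 by rewrite ge_min lexx.
have c2 : c <= k / (6 * expR 1) by rewrite ge_min lexx orbT.
have zz : 1 <= modulus z ^+ 2 by rewrite exprn_ege1.
have [x1|x1] := leP 1 (complex.Re z).
  rewrite max_r; last by lra.
  have h := modulusB_ge (cexp z) (-1); rewrite opprK modulusN modulus1 modulus_cexp in h.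
  have := expR_ge1Dx (complex.Re z) => h2.
  apply: le_trans (_ : 1 * modulus (cexp z + 1) <= _); last first.
    by rewrite ler_wpM2r ?modulus_ge0.
  rewrite mul1r; apply: le_trans (_ : 2^-1 * expR (complex.Re z) <= _); last by lra.
  by rewrite ler_wpM2r// expR_ge0.
have em : expR (Num.max 0 (complex.Re z)) <= expR 1.
  by rewrite ler_expR ge_max ler01 ltW.
apply: le_trans (_ : k / 6 <= _).
  apply: le_trans (_ : k / (6 * expR 1) * expR 1 <= _).
    apply: ler_pM; rewrite ?expR_ge0//.
    by rewrite le_min invr_ge0 ler0n divr_ge0 ?mulr_ge0 ?ltW.
  by rewrite invfM mulrA mulfVK// gt_eqF.
(* the zero of e^z + 1 closest to z has index n *)
have pi2 := @pi_ge2 R.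
set y := complex.Im z.
pose n := Num.trunc (`|y| / (2 * pi)).
have pp : 0 < 2 * pi :> R by lra.
have n1 : n%:R * (2 * pi) <= `|y|.
  by rewrite -ler_pdivlMr// truncn_le divr_ge0// ltW.
have n2 : `|y| < n.+1%:R * (2 * pi) by rewrite -ltr_pdivrMr// truncnS_gt.
have ny : `| `|y| - pi * (n.*2.+1)%:R | <= pi.
  have -> : (n.*2.+1)%:R = 2 * n%:R + 1 :> R by rewrite -addn1 natrD -mul2n natrM.
  have E : n.+1%:R = n%:R + 1 :> R by rewrite -addn1 natrD.
  rewrite E in n2; rewrite ler_norml; apply/andP; split; lra.
have nz : n%:R <= modulus z.
  apply: le_trans (ler_Im_modulus z); apply: le_trans n1.
  by rewrite ler_peMr//; lra.
pose d : R := (n.+1%:R * n.+2%:R)^-1.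
have np : 0 < n.+1%:R * n.+2%:R :> R by rewrite mulr_gt0.
have d0 : 0 <= d by rewrite invr_ge0 ltW.
have d1 : d <= 1 by rewrite invf_le1// -natrM ler1n muln_gt0.
have dz : 1 <= 6 * modulus z ^+ 2 * d.
  rewrite ler_pdivlMr// mul1r.
  have -> : n.+1%:R = n%:R + 1 :> R by rewrite -addn1 natrD.
  have -> : n.+2%:R = n%:R + 2 :> R by rewrite -addn2 natrD.
  apply: le_trans (_ : (2 * modulus z) * (3 * modulus z) <= _).
    by apply: ler_pM; move: (ler0n R n) nz z1; clear; lra.
  by rewrite expr2; lra.
have fin : k * d <= modulus (cexp z + 1) ->
    k / 6 <= modulus z ^+ 2 * modulus (cexp z + 1).
  move=> h; have h1 := ler_wpM2l (sqr_ge0 (modulus z)) h.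
  have h2 := ler_wpM2l (ltW k0) dz; lra.
apply: fin; have [y0|y0] := leP 0 y.
  have -> : cexp z + 1 = - (cexp (z - ipi n) - 1).
    have -> : cexp (z - ipi n) = - cexp z.
      have h := cexpD (z - ipi n) (ipi n).
      by rewrite subrK cexp_ipi mulrN1 in h; rewrite h opprK.
    by ring.
  rewrite modulusN; apply: Hk => //; first exact: offp.
  rewrite ImD ImN -/y (ger0_norm y0) in ny *; exact: ny.
have -> : cexp z + 1 = - (cexp (z + ipi n) - 1).
  by rewrite cexpD cexp_ipi; ring.
rewrite modulusN; apply: Hk => //; first exact: offm.
rewrite (ltr0_norm y0) in ny.
by rewrite ImD -/y -normrN opprD; exact: ny.
Qed.
End ComplexExponential.

(** * Order of growth and exceptional disks *)

Section GrowthOrder.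
Variable R : realType.
Implicit Types (F : Cplx R -> Cplx R) (z : Cplx R).

Lemma max_modulus_le F (r B : R) : 0 <= r ->
  (forall z, modulus z = r -> modulus (F z) <= B) -> max_modulus F r <= B.
Proof.
move=> r0 H; apply: ge_sup.
  by exists (modulus (F (rc r))), (rc r) => //; rewrite /mkset modulus_rc ger0_norm.
by move=> _ [z /= zr <-]; exact: H.
Qed.

(** The bound [B] guards against the default value of [sup] on a set that is not bounded above. *)
Lemma max_modulus_ge F (r B : R) z : (forall z, modulus z = r -> modulus (F z) <= B) ->
  modulus z = r -> modulus (F z) <= max_modulus F r.
Proof.
move=> H zr; apply: ub_le_sup; last by exists z.
by exists B => _ [w /= wr <-]; exact: H.
Qed.

Lemma limf_esup_le (g : R -> R) (b : R) : (\forall r \near +oo, g r <= b) ->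
  (limf_esup (fun r => (g r)%:E) (pinfty_nbhs R) <= b%:E)%E.
Proof.
move=> H; pose V : set R := [set r | g r <= b].
apply: (@le_trans _ _ (ereal_sup [set (g r)%:E | r in V])).
  by apply: ereal_inf_lbound; exists V.
by apply: ge_ereal_sup => _ [r /= h <-]; rewrite lee_fin.
Qed.

Lemma limf_esup_ge (g : R -> R) (b : R) : (\forall r \near +oo, b <= g r) ->
  (b%:E <= limf_esup (fun r => (g r)%:E) (pinfty_nbhs R))%E.
Proof.
move=> /near_pinftyP[r0 H]; apply: le_ereal_inf_tmp => _ [V [r1 [_ HV]] <-].
pose r := Num.max r0 r1 + 1.
have h0 : r0 < r by apply: le_lt_trans (_ : Num.max r0 r1 < _); rewrite ?le_max ?lexx// ltrDl.
have h1 : r1 < r by apply: le_lt_trans (_ : Num.max r0 r1 < _); rewrite ?le_max ?lexx ?orbT// ltrDl.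
apply: le_ereal_sup_tmp; exists (g r)%:E; last by rewrite lee_fin H.
by exists r => //; exact: HV.
Qed.

(** Constant factors in log M become the additive error ln 2 in log log M, which division by ln r
    removes. One point of each circle is enough for the lower bound. *)
Lemma growth_order_eq1 F :
  (\forall r \near +oo, forall z, modulus z = r -> modulus (F z) <= expR (2 * r)) ->
  (\forall r \near +oo, expR (r / 2) <= modulus (F (rc r))) ->
  growth_order F = 1%:E.
Proof.
move=> /near_pinftyP[r1 H1] /near_pinftyP[r2 H2].
have ln2 : 0 <= ln 2 :> R by rewrite ln_ge0// ler1n.
have key (e : R) : 0 < e -> \forall r \near +oo,
    1 - e <= ln (ln (max_modulus F r)) / ln r <= 1 + e.
  move=> e0; pose r3 := expR (1 + ln 2 / e).
  apply: (@near_pinfty _ _ (Num.max (Num.max r1 r2) (r3 + 2))) => r.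
  rewrite !gt_max => /andP[/andP[h1 h2] h3].
  have r3p : 0 < r3 by rewrite expR_gt0.
  have r0 : 0 < r by lra.
  have lr : 1 + ln 2 / e <= ln r.
    by rewrite -[leLHS]expRK ler_ln ?posrE ?expR_gt0//; rewrite /r3 in h3; lra.
  have le0 : 0 <= ln 2 / e by rewrite divr_ge0// ltW.
  have lr0 : 0 < ln r by lra.
  have lr2 : ln 2 <= e * ln r by rewrite mulrC -ler_pdivrMr//; lra.
  have ub : max_modulus F r <= expR (2 * r).
    by apply: max_modulus_le; [exact: ltW|exact: H1].
  have lb : expR (r / 2) <= max_modulus F r.
    apply: le_trans (H2 r h2) _; apply: max_modulus_ge (H1 r h1) _.
    by rewrite modulus_rc gtr0_norm.
  have M0 : 0 < max_modulus F r by apply: lt_le_trans lb; exact: expR_gt0.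
  have ub2 : ln (max_modulus F r) <= 2 * r.
    by rewrite -[leRHS]expRK ler_ln ?posrE ?expR_gt0.
  have lb2 : r / 2 <= ln (max_modulus F r).
    by rewrite -[leLHS]expRK ler_ln ?posrE ?expR_gt0.
  have ub3 : ln (ln (max_modulus F r)) <= ln 2 + ln r.
    by rewrite -lnM ?posrE// ler_ln ?posrE//; lra.
  have lb3 : ln r - ln 2 <= ln (ln (max_modulus F r)).
    by rewrite -ln_div ?posrE// ler_ln ?posrE//; lra.
  by rewrite ler_pdivlMr// ler_pdivrMr//; apply/andP; split; lra.
apply/eqP; rewrite eq_le; apply/andP; split.
  apply/lee_addgt0Pr => e e0; rewrite -EFinD; apply: limf_esup_le.
  have /near_pinftyP[r0 H] := key e e0.
  by apply: (@near_pinfty _ _ r0) => r /H/andP[].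
apply/lee_addgt0Pr => e e0; rewrite -leeBlDr// -EFinB; apply: limf_esup_ge.
have /near_pinftyP[r0 H] := key e e0.
by apply: (@near_pinfty _ _ r0) => r /H/andP[].
Qed.

(** For f itself only finiteness of the order is claimed. The bounds put log M between 1 and r, so
    log log M lies between 0 and ln r. *)
Lemma growth_order_fin_num F :
  (\forall r \near +oo, forall z, modulus z = r -> modulus (F z) <= expR r) ->
  (\forall r \near +oo, expR 1 <= modulus (F (rc r))) ->
  growth_order F \is a fin_num.
Proof.
move=> /near_pinftyP[r1 H1] /near_pinftyP[r2 H2].
have key : \forall r \near +oo, 0 <= ln (ln (max_modulus F r)) / ln r <= 1.
  apply: (@near_pinfty _ _ (Num.max (Num.max r1 r2) 1)) => r.
  rewrite !gt_max => /andP[/andP[h1 h2] h3].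
  have r0 : 0 < r by lra.
  have lr0 : 0 < ln r by rewrite ln_gt0.
  have ub : max_modulus F r <= expR r.
    by apply: max_modulus_le; [exact: ltW|exact: H1].
  have lb : expR 1 <= max_modulus F r.
    apply: le_trans (H2 r h2) _; apply: max_modulus_ge (H1 r h1) _.
    by rewrite modulus_rc gtr0_norm.
  have M0 : 0 < max_modulus F r by apply: lt_le_trans lb; exact: expR_gt0.
  have ub2 : ln (max_modulus F r) <= r.
    by rewrite -[leRHS]expRK ler_ln ?posrE ?expR_gt0.
  have lb2 : 1 <= ln (max_modulus F r).
    by rewrite -[leLHS]expRK ler_ln ?posrE ?expR_gt0.
  apply/andP; split; first by apply: divr_ge0; [exact: ln_ge0|exact: ltW].
  by rewrite ler_pdivrMr// mul1r ler_ln ?posrE//; lra.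
have /near_pinftyP[r0 H] := key.
have h1 : (growth_order F <= 1%:E)%E.
  by apply: limf_esup_le; apply: (@near_pinfty _ _ r0) => r /H/andP[].
have h2 : (0%:E <= growth_order F)%E.
  by apply: limf_esup_ge; apply: (@near_pinfty _ _ r0) => r /H/andP[].
apply: fin_real; apply/andP; split.
  by apply: lt_le_trans h2; exact: ltNyr.
by apply: le_lt_trans h1 _; exact: ltry.
Qed.

Lemma Re_polar (r t : R) : complex.Re (polar r t) = r * cos t. Proof. by []. Qed.

(** The indicator is max(0, cos t), as max(0, Re z) = r max(0, cos t). The order concerns entire
    circles, disks included, so its lower bound comes from a separate hypothesis on the positive
    axis. *)
Lemma crg_order1 F (c : nat -> Cplx R) (rad : nat -> R) :
  exceptional_disks c rad ->
  (forall e : R, 0 < e -> \forall r \near +oo, forall z, modulus z = r ->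
     modulus (F z) <= expR (Num.max 0 (complex.Re z) + e * r)) ->
  (\forall r \near +oo, forall z, modulus z = r ->
     (forall j, ~ modulus (z - c j) < rad j) ->
     expR (Num.max 0 (complex.Re z)) <= modulus (F z)) ->
  (\forall r \near +oo, expR (r / 2) <= modulus (F (rc r))) ->
  completely_regular_growth F.
Proof.
move=> Hd Hu /near_pinftyP[r1 Hl] Hp.
exists 1, (fun t => Num.max 0 (cos t)), c, rad; split => //.
- apply: growth_order_eq1 => //.
  have /near_pinftyP[r0 H] := Hu 1 ltr01.
  apply: (@near_pinfty _ _ r0) => r /H h z zr; apply: le_trans (h z zr) _.
  rewrite ler_expR mul1r mulrDl !mul1r lerD2r ge_max -zr modulus_ge0 /=.
  exact: le_trans (ler_norm _) (ler_Re_modulus _).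
- by move=> t; rewrite [2 * pi]mulr_natl cosD2pi.
- by exists 0; rewrite cos0 max_r//; apply/eqP; rewrite oner_eq0.
move=> e e0; have /near_pinftyP[r0 H] := Hu e e0.
apply: (@near_pinfty _ _ (Num.max (Num.max r0 r1) 0)) => r.
rewrite !gt_max => /andP[/andP[h0 h1] rp] t Ht.
have mr : modulus (polar r t) = r by rewrite modulus_polar// ltW.
have := H r h0 _ mr; have := Hl r h1 _ mr Ht.
rewrite Re_polar powRr1 ?(ltW rp)//.
have -> : Num.max 0 (r * cos t) = Num.max 0 (cos t) * r.
  by rewrite [RHS]mulrC maxr_pMr ?mulr0// ltW.
set x := Num.max 0 (cos t) * r => l u.
have M0 : 0 < modulus (F (polar r t)) by apply: lt_le_trans l; exact: expR_gt0.
split; first by apply/eqP; rewrite -modulus_gt0.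
have u2 : ln (modulus (F (polar r t))) <= x + e * r.
  by rewrite -[leRHS]expRK ler_ln ?posrE ?expR_gt0.
have l2 : x <= ln (modulus (F (polar r t))).
  by rewrite -[leLHS]expRK ler_ln ?posrE ?expR_gt0.
by rewrite ler_norml; apply/andP; split; have := mulr_gt0 e0 rp; lra.
Qed.
End GrowthOrder.

(** * Exceptional disks around the zeros of f and of e^z + 1 *)

Section ExceptionalDisks.
Variable R : realType.

(* Index 3k: the zero -16^k of f; indices 3k+1 and 3k+2: the zeros
   of e^z + 1. *)
Definition centers (j : nat) : Cplx R :=
  if (j %% 3 == 0)%N then rc (- 16 ^+ (j %/ 3))
  else if (j %% 3 == 1)%N then ipi R (j %/ 3) else - ipi R (j %/ 3).

(* Differences, so that the sums of radii telescope. *)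
Definition radA (k : nat) : R := 16 ^+ k.+1 / k.+2%:R - 16 ^+ k / k.+1%:R.
Definition radB (k : nat) : R := (k.+1%:R * k.+2%:R)^-1.

Definition radii (j : nat) : R :=
  if (j %% 3 == 0)%N then radA (j %/ 3) else radB (j %/ 3).

(** Since k + 2 <= 2(k + 1), the difference is at least (16/2 - 1) 16^k/(k+1); this is the source of
    the constant 7 in the distance conditions. *)
Lemma radA_ge k : 7 * 16 ^+ k / k.+1%:R <= radA k.
Proof.
rewrite /radA exprS.
have p1 : 0 < k.+1%:R :> R by [].
have p2 : 0 < k.+2%:R :> R by [].
have -> : k.+2%:R = k.+1%:R + 1 :> R by rewrite -[k.+2]addn1 natrD.
have q1 : 1 <= k.+1%:R :> R by rewrite ler1n.
set x : R := k.+1%:R in p1 q1 *; set y := 16 ^+ k.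
have y0 : 0 < y by rewrite exprn_gt0.
have x1 : 0 < x + 1 by lra.
have : (x + 1)^-1 >= (2 * x)^-1 by rewrite lef_pV2 ?posrE//; lra.
rewrite invfM => h.
have := ler_wpM2l (ltW y0) h; move: (x^-1) ((x + 1)^-1) => u v; clear; lra.
Qed.

Lemma radA_ge0 k : 0 <= radA k.
Proof.
by apply: le_trans (radA_ge k); rewrite divr_ge0 ?mulr_ge0 ?exprn_ge0.
Qed.

Lemma radB_ge0 k : 0 <= radB k.
Proof. by rewrite invr_ge0 mulr_ge0. Qed.

Lemma radB_telescope k : radB k = k.+1%:R^-1 - k.+2%:R^-1.
Proof.
rewrite /radB.
have -> : k.+2%:R = k.+1%:R + 1 :> R by rewrite -[k.+2]addn1 natrD.
have p1 : 0 < k.+1%:R :> R by [].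
move: (k.+1%:R) p1 => x p1; field; apply/andP; split; rewrite gt_eqF//; lra.
Qed.

Lemma radii_ge0 j : 0 <= radii j.
Proof. by rewrite /radii; case: ifP => _; rewrite ?radA_ge0 ?radB_ge0. Qed.

Lemma div3 k : ((3 * k) %/ 3 = k /\ (3 * k) %% 3 = 0)%N.
Proof. by rewrite mulKn// modnMr. Qed.
Lemma div31 k : ((3 * k + 1) %/ 3 = k /\ (3 * k + 1) %% 3 = 1)%N.
Proof. by rewrite [(3 * k)%N]mulnC divnMDl// modnMDl divn_small// addn0. Qed.
Lemma div32 k : ((3 * k + 2) %/ 3 = k /\ (3 * k + 2) %% 3 = 2)%N.
Proof. by rewrite [(3 * k)%N]mulnC divnMDl// modnMDl divn_small// addn0. Qed.

Lemma centers0 k : centers (3 * k) = rc (- 16 ^+ k).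
Proof. by rewrite /centers; case: (div3 k) => -> ->. Qed.
Lemma centers1 k : centers (3 * k + 1) = ipi R k.
Proof. by rewrite /centers; case: (div31 k) => -> ->. Qed.
Lemma centers2 k : centers (3 * k + 2) = - ipi R k.
Proof. by rewrite /centers; case: (div32 k) => -> ->. Qed.
Lemma radii0 k : radii (3 * k) = radA k.
Proof. by rewrite /radii; case: (div3 k) => -> ->. Qed.
Lemma radii1 k : radii (3 * k + 1) = radB k.
Proof. by rewrite /radii; case: (div31 k) => -> ->. Qed.
Lemma radii2 k : radii (3 * k + 2) = radB k.
Proof. by rewrite /radii; case: (div32 k) => -> ->. Qed.

Lemma sum_radA (m n : nat) :
  \sum_(k < n) (if (k <= m)%N then radA k else 0) <= 16 ^+ m.+1 / m.+2%:R.
Proof.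
have H i : (i <= m.+1)%N -> \sum_(k < i) (if (k <= m)%N then radA k else 0) <= 16 ^+ i / i.+1%:R.
  elim: i => [|i IH] im.
    by rewrite big_ord0 expr0 divr_ge0.
  have -> : 16 ^+ i.+1 / i.+2%:R = 16 ^+ i / i.+1%:R + radA i.
    by rewrite /radA addrC subrK.
  by rewrite big_ord_recr /= ifT// lerD2r IH// ltnW.
have mono k : 16 ^+ k / k.+1%:R <= 16 ^+ k.+1 / k.+2%:R :> R.
  by rewrite -subr_ge0; exact: radA_ge0.
have [nm|mn] := leqP n m.
  apply: le_trans (H n (leqW nm)) _; elim: m nm {H} => [|m IH].
    by rewrite leqn0 => /eqP ->; exact: mono.
  rewrite leq_eqVlt => /predU1P[->|nm]; first exact: mono.
  exact: le_trans (IH nm) (mono _).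
rewrite -(subnKC mn); elim: (n - m.+1)%N => [|i IH].
  by rewrite addn0; exact: H.
rewrite addnS big_ord_recr /= ifF ?addr0//.
by apply/negbTE; rewrite -ltnNge ltnS leq_addr.
Qed.

Lemma sum_radB (n : nat) : \sum_(k < n) radB k <= 1.
Proof.
suff -> : \sum_(k < n) radB k = 1 - n.+1%:R^-1 by rewrite gerBl.
elim: n => [|n IH]; first by rewrite big_ord0 invr1 subrr.
by rewrite big_ord_recr /= IH radB_telescope; ring.
Qed.

Lemma sum_radii (r : R) (m n : nat) : r < 16 ^+ m.+1 ->
  \sum_(j < 3 * n) (if modulus (centers j) <= r then radii j else 0) <=
  16 ^+ m.+1 / m.+2%:R + 2.
Proof.
move=> rm; pose g j := if modulus (centers j) <= r then radii j else 0.
have -> : \sum_(j < 3 * n) g j =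
    \sum_(k < n) (g (3 * k)%N + (g (3 * k + 1)%N + g (3 * k + 2)%N)).
  elim: n => [|n IH]; first by rewrite muln0 !big_ord0.
  rewrite mulnS addnC !addnS addn0 !big_ord_recr /= IH.
  by rewrite addn1 addn2 !addrA.
rewrite big_split /=; apply: lerD.
  apply: le_trans (sum_radA m n); apply: ler_sum => k _.
  rewrite /g centers0 radii0.
  rewrite modulus_rc normrN ger0_norm ?exprn_ge0//.
  case: ifP => h; case: ifP => h2 //; last exact: radA_ge0.
  exfalso; move/negbT: h2; rewrite -ltnNge => mk.
  have : 16 ^+ m.+1 <= 16 ^+ k :> R by rewrite ler_weXn2l ?ler1n.
  lra.
apply: le_trans (_ : \sum_(k < n) (radB k + radB k) <= _).
  apply: ler_sum => k _; rewrite /g centers1 centers2 radii1 radii2.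
  by apply: lerD; case: ifP => _ //; exact: radB_ge0.
by rewrite big_split /=; have := sum_radB n; lra.
Qed.

(** For 16^m <= r < 16^(m+1) the radii sum to at most 16^(m+1)/(m+2) + 2, hence to at most 16
    r/(m+2) + 2, which is o(r) because m grows with r. *)
Lemma exceptional_disks_centers : exceptional_disks centers radii.
Proof.
split; first exact: radii_ge0.
move=> e e0; pose M := Num.bound (32 / e).
apply: (@near_pinfty _ _ (Num.max (16 ^+ M) (4 / e))) => r.
rewrite gt_max => /andP[rM re].
have r1 : 1 <= r by apply: le_trans (ltW rM); rewrite exprn_ege1// ler1n.
have [m [m1 m2]] := scale16 r1.
have Mm : (M <= m)%N.
  rewrite -ltnS ltnNge; apply/negP => h.
  have : 16 ^+ m.+1 <= 16 ^+ M :> R by rewrite ler_weXn2l ?ler1n.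
  lra.
have B : 16 ^+ m.+1 / m.+2%:R + 2 <= e * r.
  have h1 : 32 / e <= m.+2%:R.
    apply: le_trans (ltW (archi_boundP _)) _; first by rewrite divr_ge0// ltW.
    by rewrite ler_nat; apply: leq_trans Mm _; rewrite 2?leqW.
  have h2 : 16 ^+ m.+1 / m.+2%:R <= 2^-1 * (e * r).
    rewrite ler_pdivrMr// exprS; move: h1; rewrite ler_pdivrMr// => h1.
    have := ler_wpM2r (_ : 0 <= r) h1 => /(_ (ltac:(lra))); lra.
  have h3 : 4 <= e * r by move: re; rewrite ltr_pdivrMr//; lra.
  apply: le_trans (lerD h2 (lexx 2)) _; lra.
rewrite -(@nneseries_esum R (fun j => (radii j)%:E)
  (fun j => (modulus (centers j) <= r)%R)); last first.
  by move=> n _; rewrite lee_fin radii_ge0.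
apply: lime_le.
  by apply: is_cvg_nneseries_cond => n _ _; rewrite lee_fin radii_ge0.
apply: nearW => n; rewrite sumEFin lee_fin; apply: le_trans B.
apply: le_trans (sum_radii n m2).
rewrite big_mkcond big_mkord.
pose g j := if modulus (centers j) <= r then radii j else 0.
have g0 j : 0 <= g j by rewrite /g; case: ifP => // _; exact: radii_ge0.
have H i : \sum_(j < n) g j <= \sum_(j < n + i) g j.
  elim: i => [|i IH]; first by rewrite addn0.
  by rewrite addnS big_ord_recr /=; apply: le_trans IH _; rewrite lerDl.
(* Extending the sum from n to 3n terms completes the triples counted by [sum_radii]. *)
by have := H (2 * n)%N; rewrite -mulSn.
Qed.

Lemma off_centers (z : Cplx R) : (forall j, ~ modulus (z - centers j) < radii j) ->
  [/\ (forall k, 7 <= k.+1%:R * modulus (1 + rc (q R ^+ k) * z)),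
      (forall k, (k.+1%:R * k.+2%:R)^-1 <= modulus (z - ipi R k)) &
      (forall k, (k.+1%:R * k.+2%:R)^-1 <= modulus (z + ipi R k))].
Proof.
move=> H; split => k.
- have := H (3 * k)%N; rewrite centers0 radii0.
  move=> /negP; rewrite -leNgt => h.
  have Q0 := qX_gt0 R k.
  have E : q R ^+ k * 16 ^+ k = 1 by rewrite -exprMn mulVf// expr1n.
  have -> : 1 + rc (q R ^+ k) * z = rc (q R ^+ k) * (z - rc (- 16 ^+ k)).
    have -> : rc (- 16 ^+ k : R) = - rc (16 ^+ k) by rewrite /rc rmorphN.
    by rewrite opprK mulrDr -rcM E rc1 addrC.
  rewrite modulus_qX.
  have h2 := ler_wpM2l (ltW Q0) (le_trans (radA_ge k) h).
  have p : 0 < k.+1%:R :> R by [].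
  have h3 := ler_wpM2l (ltW p) h2; apply: le_trans h3.
  have -> : k.+1%:R * (q R ^+ k * (7 * 16 ^+ k / k.+1%:R)) =
     7 * (q R ^+ k * 16 ^+ k) * (k.+1%:R / k.+1%:R) by ring.
  by rewrite E divff ?gt_eqF// !mulr1.
- have := H (3 * k + 1)%N; rewrite centers1 radii1.
  by move=> /negP; rewrite -leNgt.
- have := H (3 * k + 2)%N; rewrite centers2 radii2.
  by move=> /negP; rewrite -leNgt opprK.
Qed.
End ExceptionalDisks.

(** * The coefficients of the equation *)

Section Coefficients.
Variable R : realType.
Implicit Types (F G : Cplx R -> Cplx R) (z : Cplx R).

Lemma entire_add F G : entire F -> entire G -> entire (fun z => F z + G z).
Proof. by move=> hF hG z; apply: derivableD. Qed.
Lemma entire_mul F G : entire F -> entire G -> entire (fun z => F z * G z).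
Proof. by move=> hF hG z; apply: derivableM. Qed.
Lemma entire_opp F : entire F -> entire (fun z => - F z).
Proof. by move=> hF z; apply: derivableN. Qed.
Lemma entire_cst (c : Cplx R) : entire (fun=> c).
Proof. by move=> z; apply: derivable_cst. Qed.
Lemma entire_id : entire (fun z : Cplx R => z).
Proof. by move=> z; apply: derivable_id. Qed.
Lemma entire_exp F n : entire F -> entire (fun z => F z ^+ n).
Proof.
move=> hF; elim: n => [|n IH].
  by under [X in entire X]funext do rewrite expr0; exact: entire_cst.
by under [X in entire X]funext do rewrite exprS; exact: entire_mul.
Qed.
Lemma is_derive_entire F G : (forall z, is_derive z 1 F (G z)) -> entire F.
Proof. by move=> H z; case: (H z). Qed.
Lemma is_derive_derive1 F G : (forall z, is_derive z 1 F (G z)) -> derive1 F = G.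
Proof. by move=> H; apply/funext => z; rewrite derive1E; case: (H z). Qed.

Local Notation f := (@fser R).
Local Notation f1 := (@fser1 R).
Local Notation f2 := (@fser2 R).
Local Notation P := (@Pser R).
Local Notation N := (@Nser R).
Local Notation fr := (pser_real (fcoef R)).
Local Notation c0 := (ncoef R 0).

Lemma is_derive_fser z : is_derive z 1 f (f1 z).
Proof. exact: pser_deriv (@entire_fcoef R). Qed.
Lemma is_derive_fser1 z : is_derive z 1 f1 (f2 z).
Proof. exact: pser_deriv (@entire_fcoef1 R). Qed.

Lemma entire_fser : entire f.
Proof. exact: is_derive_entire is_derive_fser. Qed.
Lemma entire_fser1 : entire f1.
Proof. exact: is_derive_entire is_derive_fser1. Qed.
Lemma entire_pser (a : nat -> R) : entire_coef a -> entire (pser a).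
Proof. by move=> ea; apply: is_derive_entire => z; exact: pser_deriv. Qed.

(** The exponent 4 is a budget: two powers of |z| are lost near the zeros of e^z + 1, one in |f'| >=
    |f|/|z| when a_0 is estimated, and the last one beats the constants. *)
Definition acoef1 z : Cplx R :=
  z ^+ 4 * f z ^+ 2 * (cexp z + 1) + f2 z * (z * P z) * rc c0^-1.
Definition acoef0 z : Cplx R :=
  - (f2 z * N z * rc c0^-1) - z ^+ 4 * f z * f1 z * (cexp z + 1).

Lemma entire_cexp1 : entire (fun z : Cplx R => cexp z + 1).
Proof.
apply: entire_add; last exact: entire_cst.
exact: is_derive_entire (@is_derive_cexp R).
Qed.

Lemma entire_acoef1 : entire acoef1.
Proof.
apply: entire_add; apply: entire_mul.
- by apply: entire_mul; apply: entire_exp; [exact: entire_id|exact: entire_fser].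
- exact: entire_cexp1.
- apply: entire_mul; first exact: entire_pser (@entire_fcoef2 R).
  by apply: entire_mul; [exact: entire_id|exact: entire_pser (@entire_pcoef R)].
- exact: entire_cst.
Qed.

Lemma entire_acoef0 : entire acoef0.
Proof.
apply: entire_add; apply: entire_opp; apply: entire_mul.
- apply: entire_mul; first exact: entire_pser (@entire_fcoef2 R).
  exact: entire_pser (@entire_ncoef R).
- exact: entire_cst.
- apply: entire_mul; last exact: entire_fser1.
  by apply: entire_mul; [apply: entire_exp; exact: entire_id|exact: entire_fser].
- exact: entire_cexp1.
Qed.

Lemma acoef_ode z : f2 z + acoef1 z * f1 z + acoef0 z * f z = 0.
Proof.
have B := bezoutE z; rewrite /bezout in B.
have C : rc c0 * rc c0^-1 = 1 by rewrite -rcM divff// gt_eqF// ncoef0_gt0.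
rewrite /acoef1 /acoef0; move: (f z) (f1 z) (f2 z) (P z) (N z) (cexp z) (rc c0^-1) B C.
move=> u u1 u2 p n E d B C.
transitivity (u2 * (1 - (n * u - z * p * u1) * d)); first by ring.
by rewrite B C subrr mulr0.
Qed.

(** * Upper and lower bounds for the coefficients *)

Lemma modulus_fser_le z : modulus (f z) <= fr (modulus z).
Proof. exact: modulus_pser_le (@fcoef_ge0 R) (@entire_fcoef R) z. Qed.

Lemma acoef_upper : exists K : R, 0 < K /\ forall z, 1 <= modulus z ->
  modulus (acoef1 z) <= K * modulus z ^+ 4 * fr (4 * modulus z) ^+ 2 *
                        expR (Num.max 0 (complex.Re z)) /\
  modulus (acoef0 z) <= K * modulus z ^+ 4 * fr (4 * modulus z) ^+ 2 *
                        expR (Num.max 0 (complex.Re z)).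
Proof.
have c00 := ncoef0_gt0 R; have i0 : 0 <= c0^-1 by rewrite invr_ge0 ltW.
exists (2 + 12 * c0^-1); split; first by lra.
move=> z z1; set r := modulus z in z1 *; set G := fr (4 * r).
set e := expR _.
have r0 : 0 <= r by lra.
have e1 : 1 <= e.
  by rewrite /e -expR0 ler_expR le_max lexx.
have FG : fr r <= G by apply: fr_mono; lra.
have G1 : 1 <= G by apply: le_trans (fr_ge1 _) => //; lra.
have fG : modulus (f z) <= G by apply: le_trans (modulus_fser_le z) FG.
have d0 := @deriv_coef_ge0 R _ (@fcoef_ge0 R).
have f1G2 : pser_real (deriv_coef (fcoef R)) r <= fr (2 * r).
  exact: pser_real_deriv_le (@fcoef_ge0 R) (@entire_fcoef R) _ z1.
have f1G : modulus (f1 z) <= G.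
  apply: le_trans (modulus_pser_le d0 (@entire_fcoef1 R) z) _.
  by apply: le_trans f1G2 _; apply: fr_mono; lra.
have f2G : modulus (f2 z) <= G.
  have d1 := @deriv_coef_ge0 R _ d0.
  apply: le_trans (modulus_pser_le d1 (@entire_fcoef2 R) z) _.
  apply: le_trans (pser_real_deriv_le d0 (@entire_fcoef1 R) z1) _.
  have r2 : 1 <= 2 * r by lra.
  apply: le_trans (pser_real_deriv_le (@fcoef_ge0 R) (@entire_fcoef R) r2) _.
  by apply: fr_mono; lra.
have PG : modulus (P z) <= 3 * G.
  apply: le_trans (modulus_pser_dominated (@fcoef_ge0 R) (@entire_fcoef R) z _ (@Pcoef_le R)) _ => //.
  by rewrite ler_pM2l.
have NG : modulus (N z) <= 12 * G.
  apply: le_trans (modulus_pser_dominated (@fcoef_ge0 R) (@entire_fcoef R) z _ (@Ncoef_le R)) _ => //.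
  by rewrite ler_pM2l.
have Ee : modulus (cexp z + 1) <= 2 * e.
  apply: le_trans (modulusD _ _) _; rewrite modulus1 modulus_cexp.
  have : expR (complex.Re z) <= e by rewrite ler_expR le_max lexx orbT.
  lra.
have G0 : 0 <= G by lra.
have e0 : 0 <= e by lra.
have r4 : 1 <= r ^+ 4 by rewrite exprn_ege1.
have rr4 : r <= r ^+ 4 by rewrite exprS ler_peMr// exprn_ege1.
have md := @modulus_ge0 R.
have r40 : 0 <= r ^+ 4 by lra.
have G20 : 0 <= G ^+ 2 by rewrite exprn_ge0.
have ci : modulus (rc c0^-1) = c0^-1 by rewrite modulus_rc ger0_norm.
have main u v : modulus u <= G -> modulus v <= G ->
    modulus (z ^+ 4 * u * v * (cexp z + 1)) <= 2 * (r ^+ 4 * G ^+ 2 * e).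
  move=> uG vG; rewrite 3!modulusM modulusX -/r.
  have -> : 2 * (r ^+ 4 * G ^+ 2 * e) = r ^+ 4 * G * G * (2 * e) by ring.
  by do 2?[apply: ler_pM; rewrite ?mulr_ge0 ?md//]; rewrite ler_wpM2l.
split.
- apply: le_trans (modulusD _ _) _.
  have -> : z ^+ 4 * f z ^+ 2 * (cexp z + 1) = z ^+ 4 * f z * f z * (cexp z + 1) by ring.
  have h := main _ _ fG fG.
  have h2 : modulus (f2 z * (z * P z) * rc c0^-1) <= 12 * c0^-1 * (r ^+ 4 * G ^+ 2 * e).
    rewrite !modulusM ci -/r.
    have -> : 12 * c0^-1 * (r ^+ 4 * G ^+ 2 * e) = (G * (r ^+ 4 * (12 * G))) * c0^-1 * e by ring.
    apply: le_trans (_ : (G * (r ^+ 4 * (12 * G))) * c0^-1 <= _).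
      rewrite ler_wpM2r//; apply: ler_pM; rewrite ?mulr_ge0 ?md//.
      apply: ler_pM; rewrite ?md//.
      by apply: le_trans PG _; lra.
    by rewrite ler_peMr ?mulr_ge0.
  lra.
- apply: le_trans (modulusB _ _) _; rewrite modulusN.
  have h := main _ _ fG f1G.
  have h2 : modulus (f2 z * N z * rc c0^-1) <= 12 * c0^-1 * (r ^+ 4 * G ^+ 2 * e).
    rewrite !modulusM ci.
    have -> : 12 * c0^-1 * (r ^+ 4 * G ^+ 2 * e) = (G * (12 * G)) * c0^-1 * (r ^+ 4 * e) by ring.
    apply: le_trans (_ : (G * (12 * G)) * c0^-1 <= _).
      by rewrite ler_wpM2r//; apply: ler_pM; rewrite ?md.
    rewrite ler_peMr ?mulr_ge0//.
    by rewrite -[leLHS]mulr1; apply: ler_pM.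
  lra.
Qed.

Lemma subexponential (K e : R) : 0 < K -> 0 < e ->
  \forall r \near +oo, K * r ^+ 4 * fr (4 * r) ^+ 2 <= expR (e * r).
Proof.
move=> K0 e0; have [D [D0 HD]] := ln_fr_le R.
have /near_pinftyP[r0 H] := @polylog_le_powR R (`|ln K| + 4 + 2 * D) 1 e ltr01 e0.
apply: (@near_pinfty _ _ (Num.max r0 1)) => r; rewrite gt_max => /andP[h0 h1].
have r1 : 1 <= r by exact: ltW.
have rp : 0 < r by lra.
have := H r h0; rewrite powRr1 ?(ltW rp)// => h2.
have Dr := HD r r1.
have G0 : 0 < fr (4 * r) by apply: lt_le_trans (fr_ge1 _) => //; lra.
have p1 : 0 < K * r ^+ 4 by rewrite mulr_gt0// exprn_gt0.
have p2 : 0 < fr (4 * r) ^+ 2 by rewrite exprn_gt0.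
rewrite -ler_ln ?posrE ?expR_gt0 ?mulr_gt0// expRK.
rewrite lnM ?posrE// lnM ?posrE ?exprn_gt0// !lnXn//.
apply: le_trans h2.
have l0 : 0 <= ln r by rewrite ln_ge0.
have s1 : 2 + ln r <= (2 + ln r) ^+ 2 by rewrite expr2 ler_peMr//; lra.
have s2 : 1 <= (2 + ln r) ^+ 2 by lra.
have s3 := ler_norm (ln K).
have s4 : `|ln K| * 1 <= `|ln K| * (2 + ln r) ^+ 2 by rewrite ler_wpM2l.
lra.
Qed.

(** The distance condition is asked from k = 6 on because on the positive axis |1 + q^k x| >= 1 and
    k + 1 >= 7 give it exactly there. The lemma thus serves both off the disks and on that axis,
    where the order is read. *)
Lemma acoef_lower : exists r0 : R, forall z, r0 < modulus z ->
  (forall k, (6 <= k)%N -> 7 <= k.+1%:R * modulus (1 + rc (q R ^+ k) * z)) ->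
  (forall k, (k.+1%:R * k.+2%:R)^-1 <= modulus (z - ipi R k)) ->
  (forall k, (k.+1%:R * k.+2%:R)^-1 <= modulus (z + ipi R k)) ->
  expR (Num.max 0 (complex.Re z)) <= modulus (acoef1 z) /\
  expR (Num.max 0 (complex.Re z)) <= modulus (acoef0 z).
Proof.
have [c [C [m0 [c_gt0 C_gt0 far]]]] := fser_far R.
have [cE [cE0 HE]] := cexp_plus1_lower R.
have c00 := ncoef0_gt0 R.
pose M := (m0 + 6 + Num.bound c^-1)%N.
pose r0 : R := Num.max (Num.max (16 ^+ M) (2 * C / (c0 * cE)))
  (Num.max (2 * (C + 1) / cE) (2 / cE)).
exists r0 => z; rewrite !gt_max => /andP[/andP[zM z2] /andP[z3 z4]] offA offB1 offB2.
have r1 : 1 <= modulus z by apply: le_trans (ltW zM); rewrite exprn_ege1// ler1n.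
have [m [m1 m2]] := scale16 r1.
have Mm : (M <= m)%N.
  rewrite -ltnS ltnNge; apply/negP => h.
  have : 16 ^+ m.+1 <= 16 ^+ M :> R by rewrite ler_weXn2l ?ler1n.
  lra.
have m0m : (m0 <= m)%N by apply: leq_trans Mm; rewrite /M -addnA leq_addr.
have m6 : (6 <= m)%N by apply: leq_trans Mm; rewrite /M -addnA addnCA leq_addr.
have [fl f1l f2l fPl] := far m z m0m m1 (ltW m2) (offA _ m6) (offA _ (leqW m6)).
have F1 : 1 <= modulus (f z).
  apply: le_trans fl.
  have : c^-1 <= 2 ^+ m.
    apply: le_trans (ltW (archi_boundP _)) _; first by rewrite invr_ge0 ltW.
    rewrite -natrX ler_nat ltnW// (leq_ltn_trans _ (ltn_expl m (isT : (1 < 2)%N)))//.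
    by apply: leq_trans Mm; rewrite leq_addl.
  by rewrite -(ler_pM2l c_gt0) divff// gt_eqF.
have Ez := HE z r1 offB1 offB2.
set e := expR _ in Ez *.
have e1 : 1 <= e by rewrite /e -expR0 ler_expR le_max lexx.
set r := modulus z in r1 m1 m2 zM z2 z3 z4 f1l fPl Ez *.
set F := modulus (f z) in F1 fl f1l f2l fPl *.
have rp : 0 < r by lra.
have H2 : C * c0^-1 <= cE / 2 * r.
  move: z2; rewrite ltr_pdivrMr ?mulr_gt0// => h.
  by rewrite ler_pdivrMr//; lra.
have H3 : C + 1 <= cE / 2 * r by move: z3; rewrite ltr_pdivrMr//; lra.
have H4 : 1 <= cE / 2 * r by move: z4; rewrite ltr_pdivrMr//; lra.
have F2 : 1 <= F ^+ 2 by rewrite exprn_ege1.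
have strong : F ^+ 2 * (cE / 2 * r ^+ 2 * e) <= modulus (acoef1 z).
  apply: le_trans (modulusD_ge _ _).
  rewrite 2!modulusM !modulusX -/r -/F [modulus (_ * rc _)]modulusM modulus_rc.
  rewrite ger0_norm ?invr_ge0 ?(ltW c00)//.
  have s1 : modulus (f2 z * (z * P z)) * c0^-1 <= F ^+ 2 * (cE / 2 * r ^+ 2 * e).
    rewrite modulusM; apply: le_trans (_ : C * r * F ^+ 2 * c0^-1 <= _).
      by rewrite ler_wpM2r ?invr_ge0 ?(ltW c00).
    have -> : C * r * F ^+ 2 * c0^-1 = F ^+ 2 * (C * c0^-1 * r * 1) by ring.
    rewrite ler_wpM2l ?exprn_ge0 ?modulus_ge0//; apply: ler_pM => //.
      by rewrite !mulr_ge0 ?invr_ge0//; exact: ltW.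
    by rewrite expr2 mulrA ler_wpM2r// ltW.
  have s2 : F ^+ 2 * (cE * r ^+ 2 * e) <= r ^+ 4 * F ^+ 2 * modulus (cexp z + 1).
    have -> : r ^+ 4 * F ^+ 2 * modulus (cexp z + 1) =
       F ^+ 2 * (r ^+ 2 * (r ^+ 2 * modulus (cexp z + 1))) by ring.
    have -> : F ^+ 2 * (cE * r ^+ 2 * e) = F ^+ 2 * (r ^+ 2 * (cE * e)) by ring.
    rewrite ler_wpM2l ?exprn_ge0 ?modulus_ge0// ler_wpM2l// exprn_ge0//.
    exact: ltW.
  lra.
have rr : r <= r ^+ 2 by rewrite expr2 ler_peMl// ltW.
split.
  apply: le_trans strong; rewrite -[leLHS]mul1r; apply: ler_pM => //; first by lra.
  rewrite -[leLHS]mul1r ler_wpM2r//; first by lra.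
  apply: le_trans H4 _; rewrite ler_wpM2l//; lra.
have Fp : 0 < F by apply: lt_le_trans F1.
have cE2 : 0 <= cE / 2 by rewrite divr_ge0// ltW.
have e0 : 0 <= e by apply: le_trans e1.
have r_0 := ltW rp.
have E0 : acoef0 z * f z = - f2 z - acoef1 z * f1 z.
  by have := acoef_ode z => h; apply/eqP; rewrite -subr_eq0; apply/eqP; rewrite -h; ring.
have t1 : modulus (acoef1 z) * modulus (f1 z) - modulus (f2 z) <= modulus (acoef0 z) * F.
  have -> : modulus (acoef0 z) * F = modulus (acoef1 z * f1 z + f2 z).
    by rewrite /F -modulusM E0 -opprD modulusN addrC.
  by rewrite -modulusM modulusD_ge.
have t2 : cE / 2 * r * e * F <= modulus (acoef1 z) * modulus (f1 z).
  apply: le_trans (_ : cE / 2 * r ^+ 2 * e * modulus (f1 z) <= _); last first.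
    rewrite ler_wpM2r ?modulus_ge0//; apply: le_trans strong.
    by rewrite ler_peMl// (mulr_ge0 (mulr_ge0 cE2 (exprn_ge0 2 r_0)) e0).
  have -> : cE / 2 * r ^+ 2 * e * modulus (f1 z) = cE / 2 * r * e * (r * modulus (f1 z)) by ring.
  by rewrite ler_wpM2l// (mulr_ge0 (mulr_ge0 cE2 r_0) e0).
rewrite -(ler_pM2r Fp).
have t3 : (C + 1) * e * F <= cE / 2 * r * e * F.
  by rewrite (ler_pM2r Fp) ler_wpM2r.
have t4 : C * 1 * F <= C * e * F.
  by rewrite (ler_pM2r Fp) (ler_pM2l C_gt0).
by move: t1 t2 t3 t4 f2l; clear; lra.
Qed.

Lemma off_real (x : R) : 1 <= x ->
  [/\ (forall k, (6 <= k)%N -> 7 <= k.+1%:R * modulus (1 + rc (q R ^+ k) * rc x)),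
      (forall k, (k.+1%:R * k.+2%:R)^-1 <= modulus (rc x - ipi R k)) &
      (forall k, (k.+1%:R * k.+2%:R)^-1 <= modulus (rc x + ipi R k))].
Proof.
move=> x1; have bd k : (k.+1%:R * k.+2%:R)^-1 <= x.
  by apply: le_trans x1; rewrite invf_le1 ?mulr_gt0// -natrM ler1n muln_gt0.
split=> k.
- move=> k6; rewrite -rcM -rc1 -rcD modulus_rc ger0_norm; last first.
    by rewrite addr_ge0// mulr_ge0 ?(ltW (qX_gt0 _ _))//; lra.
  rewrite -[leLHS]mulr1; apply: ler_pM => //; first by rewrite ler_nat.
  by rewrite lerDl mulr_ge0 ?(ltW (qX_gt0 _ _))//; lra.
- apply: le_trans (bd k) _; apply: le_trans (ler_Re_modulus _).
  by rewrite ReD ReN /= subr0 ler_norm.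
- apply: le_trans (bd k) _; apply: le_trans (ler_Re_modulus _).
  by rewrite ReD /= addr0 ler_norm.
Qed.

Lemma crg_of_bounds F :
  (exists K : R, 0 < K /\ forall z, 1 <= modulus z -> modulus (F z) <=
     K * modulus z ^+ 4 * fr (4 * modulus z) ^+ 2 * expR (Num.max 0 (complex.Re z))) ->
  (exists r0 : R, forall z, r0 < modulus z ->
    (forall k, (6 <= k)%N -> 7 <= k.+1%:R * modulus (1 + rc (q R ^+ k) * z)) ->
    (forall k, (k.+1%:R * k.+2%:R)^-1 <= modulus (z - ipi R k)) ->
    (forall k, (k.+1%:R * k.+2%:R)^-1 <= modulus (z + ipi R k)) ->
    expR (Num.max 0 (complex.Re z)) <= modulus (F z)) ->
  completely_regular_growth F.
Proof.
move=> [K [K0 HK]] [r0 Hr0].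
apply: (crg_order1 (exceptional_disks_centers R)).
- move=> e e0; have /near_pinftyP[r1 H1] := subexponential K0 e0.
  apply: (@near_pinfty _ _ (Num.max r1 1)) => r; rewrite gt_max => /andP[h1 h2] z zr.
  apply: le_trans (HK z _) _; first by rewrite zr ltW.
  rewrite zr addrC expRD ler_wpM2r ?expR_ge0//; exact: H1.
- apply: (@near_pinfty _ _ r0) => r hr z zr Hz.
  have [k1 k2 k3] := off_centers Hz.
  by apply: Hr0 => //; rewrite zr.
- apply: (@near_pinfty _ _ (Num.max r0 1)) => r; rewrite gt_max => /andP[h1 h2].
  have rp : 0 < r by lra.
  have [k1 k2 k3] := off_real (ltW h2).
  apply: le_trans (Hr0 (rc r) _ k1 k2 k3); last by rewrite modulus_rc gtr0_norm.
  by rewrite ler_expR le_max /=; apply/orP; right; lra.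
Qed.

Lemma crg_acoef1 : completely_regular_growth acoef1.
Proof.
have [K [K0 HK]] := acoef_upper; have [r0 H] := acoef_lower.
apply: crg_of_bounds.
  by exists K; split=> // z /HK[].
by exists r0 => z h k1 k2 k3; case: (H z h k1 k2 k3).
Qed.

Lemma crg_acoef0 : completely_regular_growth acoef0.
Proof.
have [K [K0 HK]] := acoef_upper; have [r0 H] := acoef_lower.
apply: crg_of_bounds.
  by exists K; split=> // z /HK[].
by exists r0 => z h k1 k2 k3; case: (H z h k1 k2 k3).
Qed.
End Coefficients.

(** * Failure of completely regular growth *)

Section NotCRG.
Variable R : realType.
Local Notation f := (@fser R).
Local Notation fr := (pser_real (fcoef R)).

(** The points -16^k are zeros of f and are distinct; [size p] of them are too many for a nonzero
    polynomial p. *)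
Lemma fser_transcendental : transcendental_entire f.
Proof.
split; first exact: entire_fser.
move=> [p Hp].
have f00 : f 0 = 1 by rewrite /fser pserS ?mul0r ?addr0//; exact: entire_fcoef.
have p0 : p != 0.
  by apply/eqP => p0; have := Hp 0; rewrite p0 horner0 f00 => /eqP; rewrite oner_eq0.
have fN1 : f (-1) = 0 by rewrite fserE subrr mul0r.
have Q16 : rc (q R) * rc 16 = 1 by rewrite -rcM mulVf.
have zeros k : f (- rc 16 ^+ k) = 0.
  elim: k => [|k IH]; first by rewrite expr0.
  by rewrite fserE exprS mulrN mulrA Q16 mul1r IH mulr0.
pose s := [seq - rc 16 ^+ k : Cplx R | k <- iota 0 (size p)].
have : (size s < size p)%N.
  apply: max_poly_roots => //.
    by apply/allP => _ /mapP[k _ ->]; rewrite /root -Hp zeros.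
  rewrite map_inj_uniq ?iota_uniq// => i j /oppr_inj.
  rewrite -!rcX => /complexI /eqP.
  by rewrite -!natrX eqr_nat => /eqP /expnI; apply.
by rewrite size_map size_iota ltnn.
Qed.

Lemma fser_growth_fin_num : growth_order f \is a fin_num.
Proof.
apply: growth_order_fin_num.
  have /near_pinftyP[r0 H] := @subexponential R 1 1 ltr01 ltr01.
  apply: (@near_pinfty _ _ (Num.max r0 1)) => r; rewrite gt_max => /andP[h0 h1] z zr.
  apply: le_trans (modulus_fser_le z) _; rewrite zr.
  have := H r h0; rewrite !mul1r; apply: le_trans.
  have G1 : 1 <= fr (4 * r) by apply: le_trans (fr_ge1 _); lra.
  have FG : fr r <= fr (4 * r) by apply: fr_mono; lra.
  have r4 : 1 <= r ^+ 4 by rewrite exprn_ege1// ltW.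
  rewrite -[leLHS]mul1r; apply: ler_pM => //; first by apply: le_trans (fr_ge1 _); lra.
  by rewrite expr2; apply: le_trans FG _; rewrite ler_peMl//; lra.
apply: (@near_pinfty _ _ (expR 1)) => r hr.
have r0 : 0 <= r by apply: le_trans (ltW hr); exact: expR_ge0.
rewrite /fser pser_realE; last exact: entire_fcoef.
rewrite modulus_rc; apply: le_trans (ler_norm _).
by apply: le_trans (fr_ge1 r0); lra.
Qed.

(* The disks cut out of the segment S <= r <= 2 S of the ray a set of Lebesgue
   measure at most S / 2. *)
Lemma ray_avoids_disks (c : nat -> Cplx R) (rad : nat -> R) (t : R) :
  exceptional_disks c rad -> exists S0 : R, forall S, S0 < S ->
  exists r, [/\ S <= r, r <= 2 * S & forall j, ~ modulus (polar r t - c j) < rad j].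
Proof.
move=> [rad0 Hd]; have e0 : 0 < 16^-1 :> R by rewrite invr_gt0.
have /near_pinftyP[r1 H1] := Hd _ e0.
exists (Num.max r1 1) => S; rewrite gt_max => /andP[S1 Sp].
apply: contrapT => Hno.
have cover r : S <= r -> r <= 2 * S -> exists j, modulus (polar r t - c j) < rad j.
  move=> h1 h2; apply: contrapT => h3; apply: Hno; exists r; split => // j hj.
  by apply: h3; exists j.
pose J j := modulus (c j) <= 4 * S.
(* The sum taken at r = |c_j| contains [rad j] itself. So a disk with center beyond 4S is too small
   to reach the segment. *)
have far j : 4 * S < modulus (c j) -> rad j <= 16^-1 * modulus (c j).
  move=> h; rewrite -lee_fin; apply: le_trans (H1 (modulus (c j)) _); last by lra.
  apply: esum_ge; exists [set j]; last by rewrite fsbig_set1.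
  by split; [exact: finite_set1|move=> _ ->/=].
(* The orthogonal projection of c_j onto the line of the ray: the disk meets the ray within an
   interval of half-length [rad j] around it. *)
pose s j := complex.Re (c j) * cos t + complex.Im (c j) * sin t.
have near_s r j : `|r - s j| <= modulus (polar r t - c j).
  have -> : r - s j = complex.Re ((polar r t - c j) * polar 1 (- t)).
    rewrite /s; case: (c j) => x y; rewrite /polar /= cosN sinN !mul1r.
    have -> : r - (x * cos t + y * sin t) =
       r * (cos t ^+ 2 + sin t ^+ 2) - (x * cos t + y * sin t) by rewrite cos2Dsin2 mulr1.
    by ring.
  by apply: le_trans (ler_Re_modulus _) _; rewrite modulusM modulus_polar// mulr1.
pose A j : set R := if J j then `]s j - rad j, s j + rad j[%classic else set0.
have mA j : measurable (A j) by rewrite /A; case: ifP => _; [exact: measurable_itv|].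
have cov : `[S, 2 * S]%classic `<=` \bigcup_j A j.
  move=> r; rewrite /= in_itv /= => /andP[h1 h2].
  have [j hj] := cover r h1 h2; exists j => //.
  have Jj : J j.
    rewrite /J leNgt; apply/negP => h; have := far j h.
    have := modulusB_ge (c j) (polar r t); rewrite modulus_polar; last by lra.
    rewrite modulusB_sym => h4 h5; lra.
  rewrite /A Jj /= in_itv /=.
  have := le_lt_trans (near_s r j) hj; rewrite ltr_norml => /andP[h3 h4].
  by apply/andP; split; lra.
pose I : set R := `[S, 2 * S]%classic.
have : (lebesgue_measure I <= \sum_(0 <= j <oo) lebesgue_measure (A j))%E.
  exact: (measure_sigma_subadditive lebesgue_measure mA (measurable_itv _) cov).
rewrite /I lebesgue_measure_itv /= lte_fin ifT; last by lra.
rewrite -EFinB; apply/negP; rewrite -ltNge.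
(* The intervals have total length at most 2 * (4S)/16 = S/2, less than the length S of the
   segment. *)
apply: (@le_lt_trans _ _ (S / 2)%:E); last by rewrite lte_fin; lra.
apply: lime_le; first by apply: is_cvg_nneseries => n _ _; exact: measure_ge0.
apply: nearW => n.
have muA j : (lebesgue_measure (A j) <= (if J j then 2 * rad j else 0)%:E)%E.
  rewrite /A; case: ifP => _; last by rewrite measure0.
  rewrite lebesgue_measure_itv /=; case: ifP => _.
    by rewrite -EFinB lee_fin; lra.
  by rewrite lee_fin mulr_ge0.
apply: le_trans (lee_sum _ (fun j _ => muA j)) _.
rewrite sumEFin lee_fin -big_mkcond /= -mulr_sumr.
suff : \sum_(0 <= j < n | J j) rad j <= 16^-1 * (4 * S) by lra.
rewrite -lee_fin; apply: le_trans (H1 (4 * S) _); last by lra.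
rewrite -sumEFin -(@nneseries_esum R (fun j => (rad j)%:E) J); last first.
  by move=> k _; rewrite lee_fin.
by apply: nneseries_lim_ge => k _ _; rewrite lee_fin.
Qed.

(** On a ray where h is not 0, log |f| tends to infinity along points off the disks, yet stays below
    a multiple of (2 + ln r)^2. The first excludes h r^rho with rho <= 0, which is bounded, the
    second rho > 0. *)
Lemma fser_not_crg : ~ completely_regular_growth f.
Proof.
move=> [rho [h [c [rad [_ _ [t0 ht0] Hd Hf]]]]].
have [S0 HS] := ray_avoids_disks t0 Hd.
have [cf [C [m0 [cf0 C0 far]]]] := fser_far R.
have [D [D0 HD]] := ln_fr_le R.
have h0 : 0 < `|h t0| by rewrite normr_gt0; apply/eqP.
have e0 : 0 < `|h t0| / 4 by rewrite divr_gt0.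
have /near_pinftyP[r1 H1] := Hf _ e0.
(* points on the ray with f large: modulus between 4 * 16^m and 8 * 16^m *)
have good (B : R) : exists r, [/\ B < r, B <= modulus (f (polar r t0)) &
    `|ln (modulus (f (polar r t0))) - h t0 * r `^ rho| <= `|h t0| / 4 * r `^ rho].
  pose B1 := Num.max (Num.max B S0) (Num.max r1 1).
  have B11 : 1 <= B1 by rewrite !le_max lexx !orbT.
  pose m := (m0 + 20 + Num.bound (B1 / cf) + Num.bound B1)%N.
  have b2m : B1 <= 2 ^+ m.
    apply: le_trans (ltW (archi_boundP _)) _; first by lra.
    rewrite -natrX ler_nat ltnW// (leq_ltn_trans _ (ltn_expl m (isT : (1 < 2)%N)))//.
    by rewrite leq_addl.
  have b2m' : B1 / cf <= 2 ^+ m.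
    apply: le_trans (ltW (archi_boundP _)) _; first by rewrite divr_ge0//; lra.
    rewrite -natrX ler_nat ltnW// (leq_ltn_trans _ (ltn_expl m (isT : (1 < 2)%N)))//.
    by rewrite /m addnAC leq_addl.
  have l16 : 2 ^+ m <= 16 ^+ m :> R by apply: exprn_mono => //; lra.
  have p16 : 0 < 16 ^+ m :> R by rewrite exprn_gt0.
  have bB : B <= B1 by rewrite !le_max lexx.
  have bS : S0 <= B1 by rewrite !le_max lexx !orbT.
  have br : r1 <= B1 by rewrite !le_max lexx !orbT.
  (* Here |q^m z| >= 4 and |q^(m+1) z| <= 1/2, so the distance conditions of [fser_far] hold by size
     alone, whatever the angle. *)
  have [|r [r4 r8 Hr]] := HS (4 * 16 ^+ m); first by lra.
  have rp : 0 <= r by lra.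
  have mz : modulus (polar r t0) = r by rewrite modulus_polar.
  exists r; split; first by lra.
    have m20 : (20 <= m)%N.
      by rewrite /m -addnA -addnA addnCA leq_addr.
    have [|||||fl _ _ _] := far m (polar r t0).
    - by rewrite /m -!addnA leq_addr.
    - by rewrite mz; lra.
    - by rewrite mz exprS; lra.
    - have q4 : 4 <= modulus (rc (q R ^+ m) * polar r t0).
        rewrite modulus_qX mz.
        have E : q R ^+ m * 16 ^+ m = 1 by rewrite -exprMn mulVf// expr1n.
        have := ler_wpM2l (ltW (qX_gt0 R m)) r4; lra.
      have := modulus1D_ge (rc (q R ^+ m) * polar r t0) => g.
      apply: le_trans (_ : 21 * 3 <= _); first by lra.
      by apply: ler_pM => //; [rewrite ler_nat|lra].
    - have q2 : modulus (rc (q R ^+ m.+1) * polar r t0) <= 2^-1.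
        rewrite modulus_qX mz.
        have E : q R ^+ m.+1 * 16 ^+ m.+1 = 1 by rewrite -exprMn mulVf// expr1n.
        have := ler_wpM2l (ltW (qX_gt0 R m.+1)) r8.
        rewrite [16 ^+ m.+1]exprS in E; lra.
      have g := modulusD_ge (1 : Cplx R) (rc (q R ^+ m.+1) * polar r t0).
      rewrite modulus1 in g.
      apply: le_trans (_ : 22 * 2^-1 <= _); first by lra.
      by apply: ler_pM => //; [rewrite ler_nat ltnS|lra].
    apply: le_trans fl; apply: le_trans bB _.
    by rewrite mulrC -ler_pdivrMr.
  have rr : r1 < r by lra.
  exact: (H1 r rr t0 Hr).2.
have lnf r : 1 <= r -> 1 <= modulus (f (polar r t0)) ->
    0 <= ln (modulus (f (polar r t0))) <= D * (2 + ln r) ^+ 2.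
  move=> r_1 f_1; rewrite ln_ge0//=; apply: le_trans (HD r r_1).
  have rp : 0 <= r by lra.
  rewrite ler_ln ?posrE; first last.
  - by apply: lt_le_trans (fr_ge1 _); lra.
  - by lra.
  apply: le_trans (modulus_fser_le _) _; rewrite modulus_polar//.
  by apply: fr_mono; lra.
have [rho0|rho0] := leP rho 0.
  have [r [rB fB hB]] := good (expR (2 * `|h t0| + 1)).
  have r_1 : 1 <= r.
    apply: le_trans (ltW rB); rewrite -[leLHS]expR0 ler_expR; lra.
  have l1 : 2 * `|h t0| + 1 <= ln (modulus (f (polar r t0))).
    rewrite -[leLHS]expRK ler_ln ?posrE ?expR_gt0//.
    by apply: lt_le_trans fB; exact: expR_gt0.
  have pr : r `^ rho <= 1 by rewrite -(powRr0 r); exact: ler_powR.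
  have pr0 := powR_ge0 r rho.
  have u1 : h t0 * r `^ rho <= `|h t0|.
    apply: le_trans (ler_norm _) _; rewrite normrM (ger0_norm pr0).
    by rewrite ler_piMr.
  have u2 : `|h t0| / 4 * r `^ rho <= `|h t0| / 4 by rewrite ler_piMr// ltW.
  by move: hB; rewrite ler_norml => /andP[_]; lra.
(* Now log |f| is at most |h| r^rho / 8 and within |h| r^rho / 4 of h r^rho, impossible as 1/8 + 1/4
   < 1. *)
have e8 : 0 < `|h t0| / 8 by rewrite divr_gt0.
have /near_pinftyP[r2 H2] := @polylog_le_powR R D rho _ rho0 e8.
have [r [rB fB hB]] := good (Num.max r2 1).
move: rB fB; rewrite gt_max ge_max => /andP[rr2 rr1] /andP[_ f_1].
have /andP[l0 l1] := lnf r (ltW rr1) f_1.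
have l2 := le_trans l1 (H2 r rr2).
have pr : 0 < r `^ rho by rewrite powR_gt0//; lra.
have hp : `|h t0 * r `^ rho| = `|h t0| * r `^ rho by rewrite normrM (gtr0_norm pr).
have := mulr_gt0 h0 pr.
have := ler_normB (ln (modulus (f (polar r t0)))) (ln (modulus (f (polar r t0))) - h t0 * r `^ rho).
rewrite subKr hp (ger0_norm l0); lra.
Qed.
End NotCRG.

Unset Implicit Arguments.

Theorem mainTheorem3 (R : realType) :
  exists (n : nat) (a : 'I_n -> Cplx R -> Cplx R) (f : Cplx R -> Cplx R),
    (0 < n)%N /\
    (forall k, entire (a k) /\ completely_regular_growth (a k)) /\
    transcendental_entire f /\
    growth_order f \is a fin_num /\
    ~ completely_regular_growth f /\
    (forall z, derive1n n f z + \sum_(k < n) a k z * derive1n k f z = 0).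
Proof.
exists 2%N, (fun k : 'I_2 => if k == ord0 then @acoef0 R else @acoef1 R), (@fser R).
split=> //; split.
  move=> k; case: ifP => _; split.
  - exact: entire_acoef0.
  - exact: crg_acoef0.
  - exact: entire_acoef1.
  - exact: crg_acoef1.
split; first exact: fser_transcendental.
split; first exact: fser_growth_fin_num.
split; first exact: fser_not_crg.
move=> z; rewrite big_ord_recl big_ord1 /=.
have D1 := is_derive_derive1 (@is_derive_fser R).
have D2 := is_derive_derive1 (@is_derive_fser1 R).
rewrite /derive1n /= D1 D2 -[RHS](acoef_ode z); ring.
Qed.
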